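(* There exists a measurable function $\mu$ on $\mathbb{C}$ with $|\mu|\leqslant\chi_{\mathbb{D}}$ such that \[ \sigma^2(\mathcal{S}\mu) := \frac{1}{2\pi}\limsup_{R\to1^+}\, \frac{1}{|\log(R-1)|} \int_{0}^{2 \pi} |\mathcal{S} \mu (Re^{i \theta})|^2 \, d\theta > 0.87913. \]
   Context: $\mathbb{D}$ is the open unit disk and $\chi_{\mathbb{D}}$ its indicator function. The Beurling transform is $\mathcal{S}\mu(z)=-\frac{1}{\pi}\,\mathrm{p.v.}\int_{\mathbb{C}}\frac{\mu(w)}{(z-w)^2}\,dm(w)$, with $m$ Lebesgue measure; for $\mu$ supported in $\overline{\mathbb{D}}$ it is holomorphic on $\{|z|>1\}$. *)

(* Defs.v *)
From HB Require Import structures.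
From mathcomp Require Import all_boot all_order all_algebra.
From mathcomp Require Import all_classical all_reals all_analysis.
From mathcomp Require Import complex.

Set Implicit Arguments.
Unset Strict Implicit.
Unset Printing Implicit Defensive.

Import Order.TTheory GRing.Theory Num.Theory.
Import numFieldNormedType.Exports.

Local Open Scope classical_set_scope.
Local Open Scope ring_scope.

Section Beurling.
Variable R : realType.

(** Lebesgue measure m on C, identified with R x R (w = x + i y <-> (x, y)). *)
Definition leb2 := (@lebesgue_measure R \x @lebesgue_measure R)%E.

Definition to_C (p : R * R) : R[i] := (p.1 +i* p.2)%C.

Definition cnorm (z : R[i]) : R := Num.sqrt (complex.Re z ^+ 2 + complex.Im z ^+ 2).

Definition diskD : set (R * R) := [set p | p.1 ^+ 2 + p.2 ^+ 2 < 1].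

Definition cmeasurable (mu : R * R -> R[i]) : Prop :=
  measurable_fun setT (fun p => complex.Re (mu p)) /\
  measurable_fun setT (fun p => complex.Im (mu p)).

(** Beurling transform of mu, evaluated at a point z with |z| > 1, for mu
    supported in the closed unit disk.  For such z the kernel
    w |-> mu(w)/(z-w)^2 is bounded and integrable, so the principal value is
    the ordinary Lebesgue integral (taken over the whole plane, real and
    imaginary parts separately). *)
Definition beurling (mu : R * R -> R[i]) (z : R[i]) : R[i] :=
  let F := fun w => mu w / (z - to_C w) ^+ 2 in
  ((- pi^-1)%:C *
   (Rintegral leb2 setT (fun w => complex.Re (F w)) +i*
    Rintegral leb2 setT (fun w => complex.Im (F w))))%C.

Definition limsup_right (f : R -> \bar R) (a : R) : \bar R :=
  ereal_inf [set ereal_sup (f @` `]a, a + e[) | e in `]0, +oo[%classic].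

Definition sigma2 (mu : R * R -> R[i]) : \bar R :=
  ((2 * pi)^-1)%:E *
  limsup_right (fun r =>
     ((`|ln (r - 1)|)^-1)%:E *
     \int[@lebesgue_measure R]_(t in `[0%R, (2 * pi)%R]%classic)
        ((cnorm (beurling mu ((r * cos t) +i* (r * sin t))%C)) ^+ 2)%:E)%E 1.

End Beurling.

(* Main.v *)
Require Import Defs.
From HB Require Import structures.
From mathcomp Require Import all_boot all_order all_algebra.
From mathcomp Require Import all_classical all_reals all_analysis.
From mathcomp Require Import measurable_realfun complex ring lra.

(** Divide the unit disk into the shells a_k <= |w| < a_(k+1), where
    a_k ^ (20^k) = x, and on the k-th shell put mu = (w^* / w)^h with
    2h + 2 = 20^(k+1).  Rotating the variable of integration shows that the
    Beurling transform of this piece is a multiple of z^-(2h+2), and that of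
    the moments of the piece only the one of order 2h is nonzero, so that the
    multiple is -2 (1 - 20^-(k+1)) (x - x^20).  Hence S mu is a lacunary
    series, Parseval's identity gives the square mean on |z| = 1 + 20^-m, and
    about m of its terms matter: sigma^2 >= 4 (x - x^20)^2 / ln 20.  For x near
    the maximizer 20^(-1/19) of x - x^20 this is 0.879131... *)

Set Implicit Arguments.
Unset Strict Implicit.
Unset Printing Implicit Defensive.

Import Order.TTheory GRing.Theory Num.Theory.
Import numFieldNormedType.Exports.
Local Open Scope classical_set_scope.
Local Open Scope ring_scope.

(** On a shell, (conj w / w)^h is the unimodular function whose product with w^(2h) is |w|^(2h), so
    its moment of order 2h is as large as |mu| <= 1 permits. Replacing the ratio 20 of consecutive
    frequencies by d, a larger d raises the maximum of x - x^d but thins out the series, which costs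
    a factor 1 / ln d. The maximum over x of 4 (x - x^d)^2 / ln d is about 0.87905, 0.87913 and
    0.87890 for d = 19, 20, 21, whence the choice of 20; the gap to the required bound is only about
    10^-6, so the numerical estimates have to be sharp. No infinite series is handled. For fixed R >
    1 the shells from the K-th on fill an annulus whose area tends to 0 as K grows, while the kernel
    stays below (R - 1)^-2 on the disk; a finite sum and a vanishing error remain. In the same way
    the kernel is expanded to finite order with an explicit remainder. *)

HB.instance Definition _ (R : realType) := Measure.on (@Defs.leb2 R).

(** * Rotations and radial integrals in the plane *)

Section planar_measure.
Variable R : realType.
Local Notation lam := (@lebesgue_measure R).
Local Notation leb2 := (@leb2 R).
Local Notation mR := (measurableTypeR R).
Local Notation RR := (mR * mR)%type.
Implicit Types (A : set R) (B : set (R * R)).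

Lemma lebesgue_measure_translate (t : R) A : measurable A ->
  lam ((fun x => x + t) @^-1` A) = lam A.
Proof.
move=> mA.
pose tr : mR -> mR := fun x => x + t.
have mf : measurable_fun setT tr.
  by apply: measurable_funD => //; exact: measurable_id.
rewrite -[LHS]/(pushforward lam tr A); apply/esym.
apply: (@lebesgue_measure_unique R (pushforward lam tr)) => //.
move=> _ [[a b]] _ <- /=; rewrite /pushforward.
rewrite (_ : _ @^-1` _ = `]a - t, b - t]%classic); last first.
  by apply/seteqP; split => x /=; rewrite !in_itv /= ltrBlDr lerBrDr.
by rewrite !lebesgue_measure_itv /= !lte_fin ltrD2r; case: ifP => // _;
  rewrite -!EFinB; congr EFin; ring.
Qed.

Definition shearx (t : R) (p : R * R) : R * R := (p.1 + t * p.2, p.2).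
Definition sheary (t : R) (p : R * R) : R * R := (p.1, p.2 + t * p.1).

Lemma measurable_shearx t : measurable_fun setT (shearx t).
Proof.
apply: measurable_fun_pair => //.
by apply: measurable_funD => //; apply: measurable_funM.
Qed.

Lemma measurable_sheary t : measurable_fun setT (sheary t).
Proof.
apply: measurable_fun_pair => //.
by apply: measurable_funD => //; apply: measurable_funM.
Qed.

(** [leb2] is built from vertical sections, but a horizontal shear translates the horizontal ones;
    uniqueness of the product measure allows the order of integration to be exchanged. *)
Lemma leb2E B : measurable B ->
  leb2 B = (\int[lam]_y lam (ysection B y))%E.
Proof.
move=> mB; rewrite /Defs.leb2.
have -> : (lam \x lam)%E B = (lam \x^ lam)%E B.
  apply: (@product_measure_unique _ _ _ _ _ lam lam (lam \x^ lam)%E) => //.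
  by move=> X Y mX mY; exact: product_measure2E.
by [].
Qed.

(** On the section at abscissa x the shear is the translation by t x. *)
Lemma leb2_sheary t B : measurable B -> leb2 (sheary t @^-1` B) = leb2 B.
Proof.
move=> mB; rewrite /Defs.leb2 /product_measure1; apply: eq_integral => x _ /=.
rewrite -[RHS](@lebesgue_measure_translate (t * x)); last exact: measurable_xsection.
by congr (lam _); apply/seteqP; split => y /=; rewrite /xsection /= !inE.
Qed.

Lemma leb2_shearx t B : measurable B -> leb2 (shearx t @^-1` B) = leb2 B.
Proof.
move=> mB.
have mB' : measurable (shearx t @^-1` B).
  by rewrite -[_ @^-1` _]setTI; exact: measurable_shearx.
rewrite !leb2E//; apply: eq_integral => y _ /=.
rewrite -[RHS](@lebesgue_measure_translate (t * y)); last exact: measurable_ysection.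
by congr (lam _); apply/seteqP; split => x /=; rewrite /ysection /= !inE.
Qed.

Definition planar_rot (c s : R) (p : R * R) : R * R :=
  (c * p.1 - s * p.2, s * p.1 + c * p.2).

Lemma measurable_planar_rot c s : measurable_fun setT (planar_rot c s).
Proof.
apply: measurable_fun_pair.
  by apply: measurable_funB; apply: measurable_funM.
by apply: measurable_funD; apply: measurable_funM.
Qed.

(* A rotation is a product of three shears, unless it is the half-turn, which
   is the square of a quarter-turn. *)
Lemma leb2_planar_rot c s B : c ^+ 2 + s ^+ 2 = 1 -> measurable B ->
  leb2 (planar_rot c s @^-1` B) = leb2 B.
Proof.
have pre (f : R * R -> R * R) X : measurable_fun setT f -> measurable X ->
    measurable (f @^-1` X).
  by move=> mf mX; rewrite -[_ @^-1` _]setTI; exact: mf.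
have gen c' s' X : c' ^+ 2 + s' ^+ 2 = 1 -> c' != -1 -> measurable X ->
    leb2 (planar_rot c' s' @^-1` X) = leb2 X.
  (* [t] is the tangent of half the angle of rotation, which is why the half-turn has to be excluded
     here. *)
  move=> cs c1 mX; set t := s' / (1 + c').
  have c0 : 1 + c' != 0 by rewrite addrC -[1]opprK subr_eq0.
  have st : s' = t * (1 + c') by rewrite /t divfK.
  have ct : c' = 1 - t * s'.
    apply: (mulIf c0); rewrite mulrBl mulrAC -st mul1r.
    by apply/eqP; rewrite -subr_eq0; apply/eqP;
       transitivity (c' ^+ 2 + s' ^+ 2 - 1); [ring | rewrite cs subrr].
  have -> : planar_rot c' s' @^-1` X =
      shearx (- t) @^-1` (sheary s' @^-1` (shearx (- t) @^-1` X)).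
    suff -> : planar_rot c' s' = shearx (- t) \o sheary s' \o shearx (- t) by [].
    apply/funext => -[x y]; rewrite /planar_rot /shearx /sheary /=.
    congr pair.
      transitivity ((1 - t * s') * x - (t * (1 + (1 - t * s'))) * y); last by ring.
      by rewrite -ct -st.
    transitivity (s' * x + (1 - t * s') * y); last by ring.
    by rewrite -ct.
  have mx : measurable (shearx (- t) @^-1` X) by apply: pre => //;
    exact: measurable_shearx.
  have my : measurable (sheary s' @^-1` (shearx (- t) @^-1` X)).
    by apply: pre => //; exact: measurable_sheary.
  by rewrite leb2_shearx// leb2_sheary// leb2_shearx.
move=> cs mB; have [c1|] := eqVneq c (-1); last by move=> ?; exact: gen.
have s0 : s = 0.
  apply/eqP; rewrite -sqrf_eq0; apply/eqP.
  by apply: (addrI (c ^+ 2)); rewrite cs addr0 c1 sqrrN expr1n.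
have -> : planar_rot c s @^-1` B = planar_rot 0 1 @^-1` (planar_rot 0 1 @^-1` B).
  suff -> : planar_rot c s = planar_rot 0 1 \o planar_rot 0 1 by [].
  by apply/funext => -[x y]; rewrite /planar_rot /= c1 s0; congr pair; ring.
have h : (0 : R) ^+ 2 + 1 ^+ 2 = 1 by rewrite expr0n expr1n add0r.
have n1 : (0 : R) != -1 by rewrite eq_sym oppr_eq0 oner_eq0.
by rewrite !gen//; apply: pre => //; exact: measurable_planar_rot.
Qed.

(** The integrand is the length of a vertical chord of the disc of radius r. The substitution x = r
    sin t turns it into 2 (r cos t)^2, with primitive r^2 (t + sin t cos t). *)
Lemma int_sqrt_circle (r : R) : 0 < r ->
  (\int[lam]_(x in `[(- r)%R, r]) (2 * Num.sqrt (r ^+ 2 - x ^+ 2))%:E =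
   (pi * r ^+ 2)%:E)%E.
Proof.
move=> r0.
pose F : R -> R := fun t => r * sin t.
pose G : R -> R := fun x => 2 * Num.sqrt (r ^+ 2 - x ^+ 2).
have dF (t : R) : is_derive t 1 F (r * cos t) by apply: is_derive_eq;
  rewrite /GRing.scale /=; ring.
have F'E : F^`()%classic = fun t => r * cos t.
  by apply/funext => t; rewrite derive1E; exact: derive_val.
have cF' : continuous (fun t : R => r * cos t).
  by move=> t; apply: cvgM; [exact: cvg_cst | exact: continuous_cos].
have Fpi : F (pi / 2) = r by rewrite /F sin_pihalf mulr1.
have FNpi : F (- (pi / 2)) = - r by rewrite /F sinN sin_pihalf mulrN1.
have pi2 : - (pi / 2) <= pi / 2 :> R by have := @pi_gt0 R; lra.
have cG : continuous G.
  move=> t; apply: cvgM; first exact: cvg_cst.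
  apply: (@continuous_comp _ _ _ (fun x : R => r ^+ 2 - x ^+ 2) (@Num.sqrt R));
    last exact: sqrt_continuous.
  by apply: cvgB; [exact: cvg_cst | exact: exprn_continuous].
have cFc : continuous F.
  by move=> t; apply: cvgM; [exact: cvg_cst | exact: continuous_sin].
have dcF : derivable_oo_LRcontinuous F (- (pi / 2)) (pi / 2).
  by split; [move=> t _; apply: ex_derive | apply: cvg_at_right_filter;
    exact: cFc | apply: cvg_at_left_filter; exact: cFc].
have Fmono : {in `[- (pi / 2), pi / 2] &, {homo F : x y / x < y}}.
  by move=> x y xI yI xy; rewrite ltr_pM2l// ltr_sin.
have cr : cvg ((F^`()%classic) x @[x --> (- (pi / 2))^'+]).
  by rewrite F'E; apply: cvgP; apply: cvg_at_right_filter; exact: cF'.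
have cl : cvg ((F^`()%classic) x @[x --> (pi / 2)^'-]).
  by rewrite F'E; apply: cvgP; apply: cvg_at_left_filter; exact: cF'.
have cI : {in `]- (pi / 2), pi / 2[, continuous F^`()%classic} by move=> t _;
  rewrite F'E; exact: cF'.
have cGw : {within `[F (- (pi / 2)), F (pi / 2)],
  continuous G} by exact: continuous_subspaceT.
have := integration_by_substitution_increasing pi2 Fmono cI cr cl dcF cGw.
rewrite Fpi FNpi F'E => ->.
pose H : R -> R := fun t => r ^+ 2 * (t + sin t * cos t).
have dH (t : R) : is_derive t 1 H (2 * (r * cos t) ^+ 2).
  apply: is_derive_eq; rewrite /GRing.scale /=.
  have := cos2Dsin2 t; move: (cos t) (sin t) => c s cs.
  transitivity (r ^+ 2 * (c ^+ 2 + s ^+ 2 + c ^+ 2 - s ^+ 2)); last by ring.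
  by rewrite cs; ring.
have cH : continuous H by move=> t; apply: differentiable_continuous;
  apply/derivable1_diffP; apply: ex_derive.
transitivity (\int[lam]_(t in `[(- (pi / 2))%R,
  (pi / 2)%R]) (2 * (r * cos t) ^+ 2)%:E)%E.
  apply: eq_integral => t; rewrite inE /= => tI; congr EFin.
  have ct : 0 <= cos t by apply: cos_ge0_pihalf.
  rewrite -[LHS]/(2 * Num.sqrt (r ^+ 2 - (r * sin t) ^+ 2) * (r * cos t)).
  have -> : r ^+ 2 - (r * sin t) ^+ 2 = (r * cos t) ^+ 2.
    by rewrite !exprMn -[cos t ^+ 2](addrK (sin t ^+ 2)) cos2Dsin2; ring.
  by rewrite sqrtr_sqr ger0_norm ?mulr_ge0 ?(ltW r0)//; ring.
rewrite (@continuous_FTC2 R _ H).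
- by rewrite -EFinB; congr EFin; rewrite /H sinN cosN cos_pihalf; field.
- by have := @pi_gt0 R; lra.
- apply: continuous_subspaceT => t; apply: cvgM; first exact: cvg_cst.
  by apply: cvgM; exact: cF'.
- by split; [move=> t _;
  apply: ex_derive | apply: cvg_at_right_filter | apply: cvg_at_left_filter]; exact: cH.
- by move=> t _; rewrite derive1E; exact: derive_val.
Qed.

(** The squared modulus serves as radial variable: the area of a disc is linear in it, so that
    planar measure projects to a constant multiple of Lebesgue measure. *)
Definition nsq (p : R * R) : R := p.1 ^+ 2 + p.2 ^+ 2.

Lemma nsq_ge0 p : 0 <= nsq p.
Proof. by rewrite addr_ge0 ?sqr_ge0. Qed.

Lemma measurable_nsq : measurable_fun setT (nsq : RR -> mR).
Proof. by apply: measurable_funD; apply: measurable_funX. Qed.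

Lemma measurable_nsq_preimage A : @measurable _ mR A -> @measurable _ RR (nsq @^-1` A).
Proof. by move=> mA; rewrite -[_ @^-1` _]setTI; exact: measurable_nsq. Qed.

Lemma ler_norm_sqr (y q : R) : 0 <= q -> (`|y| <= q) = (y ^+ 2 <= q ^+ 2).
Proof. by move=> q0; rewrite -[in RHS](real_normK (num_real y)) ler_sqr ?nnegrE. Qed.

Lemma leb2_disc (s : R) : 0 <= s ->
  leb2 (nsq @^-1` `]-oo, s]%classic) = (pi * s)%:E.
Proof.
move=> s0; rewrite /Defs.leb2 /product_measure1.
pose r := Num.sqrt s.
have r2 : r ^+ 2 = s by rewrite sqr_sqrtr.
have xs (x : R) : lam (xsection (nsq @^-1` `]-oo, s]%classic) x) =
    (2 * Num.sqrt (r ^+ 2 - x ^+ 2))%:E.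
  have [xr|xr] := lerP (x ^+ 2) (r ^+ 2).
    set q := Num.sqrt _.
    have q2 : q ^+ 2 = s - x ^+ 2 by rewrite /q r2 sqr_sqrtr// subr_ge0 -r2.
    have q0 : 0 <= q by exact: sqrtr_ge0.
    rewrite (_ : xsection _ _ = `[- q, q]%classic).
      rewrite lebesgue_measure_itv/= lte_fin.
      case: ltP => [_|qq]; first by rewrite -EFinB; congr EFin; ring.
      by congr EFin; lra.
    apply/seteqP; split => y; rewrite /xsection /= inE /= !in_itv /= /nsq /=.
      by rewrite -ler_norml ler_norm_sqr// q2 lerBrDl.
    by rewrite -ler_norml ler_norm_sqr// q2 lerBrDl.
  (* [Num.sqrt] is 0 at negative arguments, so the formula also gives the length 0 of the empty
     sections outside the disc. *)
  rewrite ler0_sqrtr ?subr_le0 ?(ltW xr)// mulr0.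
  rewrite (_ : xsection _ _ = set0) ?measure0//.
  apply/seteqP; split => y //; rewrite /xsection /= inE /= in_itv /= /nsq /=.
  by move: xr; rewrite r2; have := sqr_ge0 y; lra.
transitivity (\int[lam]_x (2 * Num.sqrt (r ^+ 2 - x ^+ 2))%:E)%E.
  by apply: eq_integral => x _; exact: xs.
have [r0|r0] := ltrP 0 r; last first.
  have r00 : r = 0 by apply/eqP; rewrite eq_le r0 sqrtr_ge0.
  have -> : s = 0 by rewrite -r2 r00 expr0n.
  rewrite mulr0 integral0_eq// => x _.
  by rewrite ler0_sqrtr ?mulr0// r00 expr0n sub0r oppr_le0 sqr_ge0.
rewrite -r2 -int_sqrt_circle// [RHS]integral_mkcond; apply: eq_integral => x _.
rewrite patchE; case: ifPn => // /negP; rewrite inE /= in_itv /= => xr.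
rewrite ler0_sqrtr ?mulr0// subr_le0 leNgt; apply/negP => /ltW h.
by apply: xr; rewrite -ler_norml ler_norm_sqr// ltW.
Qed.

Lemma leb2_annulus (a b : R) : 0 <= a <= b ->
  leb2 (nsq @^-1` `]a, b]%classic) = (pi * (b - a))%:E.
Proof.
move=> /andP[a0 ab].
have -> : nsq @^-1` `]a, b]%classic = (nsq @^-1` `]-oo,
  b]%classic) `\` (nsq @^-1` `]-oo, a]%classic).
  apply/seteqP; split => p; rewrite /= !in_itv /=.
    by move=> /andP[ap pb]; split => //; apply/negP; rewrite -ltNge.
  by move=> [pb /negP]; rewrite -ltNge pb andbT.
have mI c : measurable (nsq @^-1` `]-oo, c]%classic) by exact: measurable_nsq_preimage.
have fin : (leb2 (nsq @^-1` `]-oo, b]%classic) < +oo)%E.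
  by rewrite leb2_disc ?(le_trans a0)// ltry.
transitivity (leb2 (nsq @^-1` `]-oo, b]%classic) - leb2 ((nsq @^-1` `]-oo,
  b]%classic) `&` (nsq @^-1` `]-oo, a]%classic)))%E.
  by apply: measureD; [exact: mI | exact: mI | exact: fin].
rewrite setIidr; last first.
  by move=> p; rewrite /= !in_itv /= => /le_trans; apply.
by rewrite !leb2_disc ?(le_trans a0)// -EFinB; congr EFin; ring.
Qed.

(* The pushforward of planar measure by the squared modulus is [pi] times
   Lebesgue measure; it suffices to compare intervals, after completing the
   pushforward by Lebesgue measure on the negative half-line. *)
Lemma leb2_nsq (A : set mR) : measurable A -> A `<=` `[0, +oo[ ->
  leb2 (nsq @^-1` A) = (pi%:E * lam A)%E.
Proof.
move=> mA A0.
have [ph phE] : exists ph : {measure set mR -> \bar R},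
    forall X, ph X = leb2 (nsq @^-1` X).
  unshelve eexists (pushforward leb2 (nsq : RR -> mR) : {measure set mR -> \bar R}).
    exact: measurable_nsq.
  by [].
have mneg : measurable (`]-oo, 0[%classic : set (measurableTypeR R)) by [].
have ipi : 0 <= pi^-1 :> R by rewrite invr_ge0 pi_ge0.
pose nu : {measure set mR -> \bar R} := measure_add (mscale (NngNum ipi) ph) (mrestr
  lam mneg).
have nuv X : nu X = ((pi^-1)%:E * leb2 (nsq @^-1` X) + lam (X `&` `]-oo, 0%R[))%E.
  by rewrite [LHS]measure_addE -phE.
have nuE : forall X, measurable X -> lam X = nu X.
  apply: lebesgue_measure_unique.
  move=> _ [[a b]] _ <- /=; rewrite [RHS]nuv.
  have [ab|ba] := ltP a b; last first.
    by rewrite set_itv_ge ?preimage_set0 ?set0I ?measure0 ?mule0 ?adde0// bnd_simp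
      -leNgt.
  have [b0|b0] := ltP b 0.
    rewrite (_ : nsq @^-1` _ = set0) ?measure0 ?mule0 ?add0e; last first.
      apply/seteqP; split => p //=; rewrite in_itv /= => /andP[_ pb].
      by have := nsq_ge0 p; lra.
    congr (lam _); apply/esym/setIidl => x /=; rewrite !in_itv /= => /andP[_ xb].
    exact: le_lt_trans xb b0.
  have [a0|a0] := ltP a 0.
    have -> : nsq @^-1` `]a, b]%classic = nsq @^-1` `]-oo, b]%classic.
      apply/seteqP; split => p /=; rewrite !in_itv /=; first by case/andP.
      by move=> ->; rewrite andbT (lt_le_trans a0)// nsq_ge0.
    rewrite (_ : _ `&` _ = `]a, 0[%classic); last first.
      apply/seteqP; split => x /=; rewrite !in_itv /=.
        by case=> /andP[-> _] ->.
      by move=> /andP[-> x0]; rewrite x0 (le_trans (ltW x0)).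
    rewrite leb2_disc// !lebesgue_measure_itv /= !lte_fin ab a0.
    rewrite -EFinM -!EFinB -EFinD; congr EFin.
    by rewrite mulKf ?gt_eqF ?pi_gt0//; ring.
  rewrite leb2_annulus ?a0 ?ltW// (_ : _ `&` _ = set0) ?measure0 ?adde0; last first.
    apply/seteqP; split => x //=; rewrite !in_itv /= => -[/andP[ax _] x0]; lra.
  by rewrite lebesgue_measure_itv /= lte_fin ab -EFinM mulKf// gt_eqF ?pi_gt0.
rewrite nuE// nuv.
rewrite (_ : A `&` _ = set0) ?measure0 ?adde0; last first.
  by apply/seteqP; split => x //= [/A0]; rewrite /= !in_itv /=; lra.
by rewrite muleA -EFinM divff ?mul1e// gt_eqF ?pi_gt0.
Qed.

(** In place of polar coordinates, the pushforward by [nsq] reduces this to pi times the integral of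
    s^h over [a, b[. *)
Lemma leb2_radial_integral (a b : R) h : 0 <= a <= b ->
  (\int[leb2]_(p in nsq @^-1` `[a, b[%classic) (nsq p ^+ h)%:E =
   (pi * (b ^+ h.+1 - a ^+ h.+1) / h.+1%:R)%:E)%E.
Proof.
move=> /andP[a0]; rewrite le_eqVlt => /predU1P[<-|ab].
  by rewrite set_itv_ge ?bnd_simp ?ltxx// preimage_set0 integral_set0 subrr mulr0 mul0r.
have dG (s : R) : is_derive s 1 (fun s : R => s ^+ h.+1 / h.+1%:R) (s ^+ h).
  rewrite (_ : (fun s => _) = h.+1%:R^-1 \*: ((id : R -> R) ^+ h.+1)); last first.
    by apply/funext => u; rewrite /= mulrC; congr (_ * _); rewrite exprfctE.
  apply: is_derive_eq; rewrite /GRing.scale /=.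
  by rewrite mulr1 mulKf ?pnatr_eq0.
have mX : measurable_fun setT (fun s : mR => (s ^+ h)%:E).
  by apply/measurable_EFinP; exact: measurable_funX.
rewrite -(@ge0_integral_pushforward _ _ _ _ R _ measurable_nsq leb2 _ (fun s : mR =>
  (s ^+ h)%:E))//.
- rewrite (@eq_measure_integral _ _ _ _ (mscale (NngNum (pi_ge0 R)) lam)).
    rewrite ge0_integral_mscale//=; last 2 first.
      by apply: measurable_funS mX.
      by move=> s; rewrite /= in_itv /= => /andP[as_ _];
        rewrite lee_fin exprn_ge0// (le_trans a0).
    rewrite integral_itv_bndo_bndc; last by apply: measurable_funS mX.
    rewrite (@continuous_FTC2 R _ (fun s => s ^+ h.+1 / h.+1%:R))//.
    + by rewrite -EFinB -EFinM; congr EFin; rewrite -mulrBl mulrA.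
    + by apply: continuous_subspaceT => x; exact: exprn_continuous.
    + split; first by move=> x _; apply: ex_derive.
        by apply: cvg_at_right_filter; apply: cvgM;
          [exact: exprn_continuous | exact: cvg_cst].
      by apply: cvg_at_left_filter; apply: cvgM;
        [exact: exprn_continuous | exact: cvg_cst].
    + by move=> x _; rewrite derive1E; exact: derive_val.
    exact: measurable_nsq.
  move=> mf X mX' Xab; rewrite -[LHS]/(leb2 (nsq @^-1` X)) -[RHS]/(pi%:E * lam X)%E;
    apply: leb2_nsq => //.
  by move=> x /Xab /=; rewrite !in_itv /= => /andP[/(le_trans a0) ->].
- by apply: measurable_funS mX.
- by move=> s; rewrite inE /= in_itv /= => /andP[as_ _];
  rewrite lee_fin exprn_ge0// (le_trans a0).
Qed.

End planar_measure.

(** * Complex-valued integrals over the disk *)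

Section complex_integral.
Variable R : realType.
Local Notation leb2 := (@leb2 R).
Local Notation mR := (measurableTypeR R).
Local Notation RR := (mR * mR)%type.
Local Notation Re := complex.Re.
Local Notation Im := complex.Im.
Local Notation normc := Normc.normc.
Implicit Types (F G : RR -> R[i]).

Lemma integral_planar_rot (c s : R) (f : RR -> \bar R) : c ^+ 2 + s ^+ 2 = 1 ->
  measurable_fun setT f ->
  (\int[leb2]_p f (planar_rot c s p) = \int[leb2]_p f p)%E.
Proof.
move=> cs.
have mrot : measurable_fun setT (planar_rot c s : RR -> RR) by exact:
  measurable_planar_rot.
have ge0 (g : RR -> \bar R) : measurable_fun setT g -> (forall p, (0 <= g p)%E) ->
    (\int[leb2]_p g (planar_rot c s p) = \int[leb2]_p g p)%E.
  move=> mg g0.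
  have := @ge0_integral_pushforward _ _ RR RR R (planar_rot c s) mrot leb2 setT g
    measurableT mg (fun p _ => g0 p).
  rewrite preimage_setT => <-.
  by apply: eq_measure_integral => A mA _; exact: leb2_planar_rot.
move=> mf.
have h (g : RR -> \bar R) : (\int[leb2]_p g p = \int[leb2]_p (g^\+ p) - \int[leb2]_p
  (g^\- p))%E.
  exact: integralE.
rewrite h [RHS]h.
have E1 := ge0 _ (measurable_funepos mf) (funepos_ge0 f).
have E2 := ge0 _ (measurable_funeneg mf) (funeneg_ge0 f).
rewrite -E1 -E2.
by congr (_ - _)%E; apply: eq_integral => p _; rewrite ?funeposE ?funenegE.
Qed.

(** * Measurability of complex-valued functions *)

Definition cmeas F := measurable_fun setT (fun p => Re (F p)) /\
  measurable_fun setT (fun p => Im (F p)).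

Lemma cmeas_cst (z : R[i]) : cmeas (fun=> z).
Proof. by split. Qed.

Lemma cmeas_ext F G : F =1 G -> cmeas F -> cmeas G.
Proof. by move=> /funext ->. Qed.

Lemma cmeas_to_C : cmeas (@to_C R).
Proof. by split; [exact: measurable_fst | exact: measurable_snd]. Qed.

Lemma complex_ReD (x y : R[i]) : Re (x + y) = Re x + Re y. Proof. by case: x y =>
  ? ? []. Qed.
Lemma complex_ImD (x y : R[i]) : Im (x + y) = Im x + Im y. Proof. by case: x y =>
  ? ? []. Qed.
Lemma complex_ReM (x y : R[i]) : Re (x * y) = Re x * Re y - Im x * Im y.
Proof. by case: x y => ? ? []. Qed.
Lemma complex_ImM (x y : R[i]) : Im (x * y) = Re x * Im y + Im x * Re y.
Proof. by case: x y => ? ? []. Qed.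

Lemma cmeasD F G : cmeas F -> cmeas G -> cmeas (fun p => F p + G p).
Proof.
move=> [F1 F2] [G1 G2]; split.
  by under eq_fun do rewrite complex_ReD; exact: measurable_funD.
by under eq_fun do rewrite complex_ImD; exact: measurable_funD.
Qed.

Lemma cmeasM F G : cmeas F -> cmeas G -> cmeas (fun p => F p * G p).
Proof.
move=> [F1 F2] [G1 G2]; split.
  by under eq_fun do rewrite complex_ReM; apply: measurable_funB;
    exact: measurable_funM.
by under eq_fun do rewrite complex_ImM; apply: measurable_funD; exact: measurable_funM.
Qed.

Lemma cmeasX F n : cmeas F -> cmeas (fun p => F p ^+ n).
Proof.
move=> mF; elim: n => [|n IH]; first exact: cmeas_cst.
by apply: (@cmeas_ext (fun p => F p * F p ^+ n)); [move=> p;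
  rewrite exprS | exact: cmeasM].
Qed.

Lemma cmeasB F G : cmeas F -> cmeas G -> cmeas (fun p => F p - G p).
Proof.
move=> mF mG; apply: (@cmeas_ext (fun p => F p + (-1) * G p)); first by move=> p;
  rewrite mulN1r.
by apply: cmeasD => //; apply: cmeasM => //; exact: cmeas_cst.
Qed.

Lemma cmeas_conj F : cmeas F -> cmeas (fun p => (F p)^*%C).
Proof.
move=> [F1 F2]; split.
  by apply: (eq_measurable_fun (fun p => Re (F p))) => // p _; case: (F p).
apply: (eq_measurable_fun (fun p => - Im (F p))) => [p _|]; first by case: (F p).
exact: measurable_funN.
Qed.

(** The inverse is rewritten as the real power of exponent -1, measurable on the whole line; both
    take the value 0 at 0. *)
Lemma measurable_sqr_norm_inv F : cmeas F ->
  measurable_fun setT (fun p => (Re (F p) ^+ 2 + Im (F p) ^+ 2)^-1).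
Proof.
move=> [F1 F2].
apply: (eq_measurable_fun (fun p => (Re (F p) ^+ 2 + Im (F p) ^+ 2) `^ (-1))).
  by move=> p _; rewrite powR_inv1// addr_ge0 ?sqr_ge0.
have mF : measurable_fun setT (fun p : RR => Re (F p) ^+ 2 + Im (F p) ^+ 2).
  by apply: measurable_funD; exact: measurable_funX.
have mp : measurable_fun setT (fun x : R => x `^ (-1)) by exact: measurable_powR.
exact: (measurableT_comp mp mF).
Qed.

Lemma cmeasV F : cmeas F -> cmeas (fun p => (F p)^-1).
Proof.
move=> mF; have mi := measurable_sqr_norm_inv mF.
case: mF => F1 F2; split.
  apply: (eq_measurable_fun (fun p => Re (F p) * (Re (F p) ^+ 2 + Im (F p) ^+ 2)^-1)).
    by move=> p _; case: (F p).
  exact: measurable_funM.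
apply: (eq_measurable_fun (fun p => - Im (F p) * (Re (F p) ^+ 2 + Im (F p) ^+ 2)^-1)).
  by move=> p _; case: (F p) => x y /=; rewrite mulNr.
by apply: measurable_funM => //; exact: measurable_funN.
Qed.

Lemma cmeas_if (A : set RR) F : measurable A -> cmeas F ->
  cmeas (fun p => if p \in A then F p else 0).
Proof.
move=> mA [F1 F2]; split.
  rewrite (_ : (fun _ => _) = (fun p => if p \in A then Re (F p) else 0)); last first.
    by apply/funext => p; case: ifP.
  apply: measurable_fun_ifT => //; apply: (@measurable_fun_bool _ _ _ _ true).
  by rewrite setTI (_ : _ @^-1` _ = A)//; apply/seteqP; split => p /=;
    [move/set_mem | move/mem_set].
rewrite (_ : (fun _ => _) = (fun p => if p \in A then Im (F p) else 0)); last first.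
  by apply/funext => p; case: ifP.
apply: measurable_fun_ifT => //; apply: (@measurable_fun_bool _ _ _ _ true).
by rewrite setTI (_ : _ @^-1` _ = A)//; apply/seteqP; split => p /=;
  [move/set_mem | move/mem_set].
Qed.

Lemma cnormE (z : R[i]) : cnorm z = normc z.
Proof. by case: z. Qed.

Lemma normc_ge0 (z : R[i]) : 0 <= normc z.
Proof. by rewrite -cnormE sqrtr_ge0. Qed.

Lemma normcX (z : R[i]) n : normc (z ^+ n) = normc z ^+ n.
Proof.
elim: n => [|n IH]; first by rewrite !expr0 Normc.normc1.
by rewrite !exprS Normc.normcM IH.
Qed.

Lemma normc_real (x : R) : normc x%:C%C = `|x|.
Proof. by rewrite /= expr0n addr0 sqrtr_sqr. Qed.

Lemma Re_le_normc (z : R[i]) : `|Re z| <= normc z.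
Proof. by rewrite -cnormE -sqrtr_sqr ler_wsqrtr// lerDl sqr_ge0. Qed.

Lemma Im_le_normc (z : R[i]) : `|Im z| <= normc z.
Proof. by rewrite -cnormE -sqrtr_sqr ler_wsqrtr// lerDr sqr_ge0. Qed.

Lemma normc_le_ReIm (z : R[i]) : normc z <= `|Re z| + `|Im z|.
Proof.
rewrite -cnormE -[leRHS]ger0_norm ?addr_ge0// -sqrtr_sqr ler_wsqrtr//.
rewrite sqrrD !real_normK ?num_real// -addrA [_ *+ 2 + _]addrC addrA lerDl.
by rewrite mulrn_wge0// mulr_ge0.
Qed.

(** Taken componentwise, exactly as in [beurling], so that [beurlingE] holds by conversion. *)
Definition cint F : R[i] :=
  (Rintegral leb2 setT (fun p => Re (F p)) +i* Rintegral leb2 setT (fun p =>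
    Im (F p)))%C.

Lemma beurlingE mu z : beurling mu z =
  (- pi^-1)%:C%C * cint (fun w => mu w / (z - to_C w) ^+ 2).
Proof. by []. Qed.

Lemma eq_cint F G : F =1 G -> cint F = cint G.
Proof. by move=> /funext ->. Qed.

Lemma cint_planar_rot c s F : c ^+ 2 + s ^+ 2 = 1 -> cmeas F ->
  cint (fun p => F (planar_rot c s p)) = cint F.
Proof.
move=> cs [F1 F2]; rewrite /cint /Rintegral; congr (fine _ +i* fine _)%C.
  by apply: (@integral_planar_rot _ _ (fun p => (Re (F p))%:E)) => //;
    exact/measurable_EFinP.
by apply: (@integral_planar_rot _ _ (fun p => (Im (F p))%:E)) => //;
  exact/measurable_EFinP.
Qed.

Lemma diskDE : @diskD R = nsq (R := R) @^-1` `]-oo, 1[.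
Proof. by apply/seteqP; split => p; rewrite /diskD /nsq /= in_itv. Qed.

Lemma measurable_diskD : @measurable _ RR (@diskD R).
Proof. by rewrite diskDE; apply: measurable_nsq_preimage. Qed.

Lemma leb2_diskD_lty : (leb2 (@diskD R) < +oo)%E.
Proof.
apply: (@le_lt_trans _ _ (leb2 (nsq (R := R) @^-1` `]-oo, 1]%classic))); last first.
  by rewrite leb2_disc// ltry.
apply: le_measure; rewrite ?inE.
- exact: measurable_diskD.
- exact: measurable_nsq_preimage.
- by rewrite diskDE => p /=; rewrite !in_itv /=; exact: ltW.
Qed.

(** A single inequality records that F is bounded and vanishes off the disk. As the disk has finite
    area, this yields integrability, hence linearity of [cint], and it is kept under multiplication
    by any measurable function bounded on the disk, such as the kernel for |z| > 1. *)
Definition tame F := cmeas F /\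
  exists M : R, forall p, normc (F p) <= M * \1_(@diskD R) p.

Lemma integrable_indic_lty (A : set RR) : measurable A -> (leb2 A < +oo)%E ->
  leb2.-integrable setT (fun p => (\1_A p)%:E).
Proof.
move=> mA Afin; apply/integrableP; split; first exact/measurable_EFinP/measurable_indic.
have -> : (\int[leb2]_x `|(\1_A x)%:E|)%E = (\int[leb2]_x (\1_A x)%:E)%E.
  by apply: eq_integral => x _; rewrite gee0_abs// lee_fin.
by rewrite integral_indic// setIT.
Qed.

Lemma integrable_EFinZl (k : R) (f : RR -> R) :
  leb2.-integrable setT (EFin \o f) ->
  leb2.-integrable setT (EFin \o (fun p => k * f p)).
Proof. by move=> intf; exact: (integrableZl measurableT k intf). Qed.

Lemma integrable_dominated (f : RR -> R) (A : set RR) (M : R) :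
  measurable A -> (leb2 A < +oo)%E ->
  measurable_fun setT f -> (forall p, `|f p| <= M * \1_A p) ->
  leb2.-integrable setT (EFin \o f).
Proof.
move=> mA Afin mf fM.
apply: (@le_integrable _ _ _ leb2 setT measurableT _ (fun p => (M * \1_A p)%:E)).
- exact/measurable_EFinP.
- by move=> p _; rewrite /= lee_fin (le_trans (fM p))// ler_norm.
- rewrite (_ : (fun _ => _) = (fun p => M%:E * (\1_A p)%:E)%E); last first.
    by apply/funext => p; rewrite EFinM.
  by apply: integrableZl => //; exact: integrable_indic_lty.
Qed.

Lemma Rintegral_dominated (f : RR -> R) (A : set RR) (M : R) :
  measurable A -> (leb2 A < +oo)%E ->
  measurable_fun setT f -> (forall p, `|f p| <= M * \1_A p) ->
  `|Rintegral leb2 setT f| <= M * fine (leb2 A).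
Proof.
move=> mA Afin mf fM.
have intf := integrable_dominated mA Afin mf fM.
apply: (le_trans (le_normr_Rintegral measurableT intf)).
have intA : leb2.-integrable setT (EFin \o (fun p => (\1_A p : R))).
  exact: integrable_indic_lty.
have -> : M * fine (leb2 A) = Rintegral leb2 setT (fun p => M * \1_A p).
  rewrite RintegralZl//; congr (_ * _); rewrite /Rintegral.
  by rewrite integral_indic// setIT.
apply: le_Rintegral => //.
- by apply: integrable_norm.
- exact: integrable_EFinZl.
Qed.

Lemma tame_integrable F : tame F ->
  leb2.-integrable setT (EFin \o (fun p => Re (F p))) /\
  leb2.-integrable setT (EFin \o (fun p => Im (F p))).
Proof.
move=> [[F1 F2] [M FM]]; split.
  apply: (integrable_dominated measurable_diskD leb2_diskD_lty F1 (M := M)) => p.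
  exact: le_trans (Re_le_normc _) (FM p).
apply: (integrable_dominated measurable_diskD leb2_diskD_lty F2 (M := M)) => p.
exact: le_trans (Im_le_normc _) (FM p).
Qed.

Lemma tameD F G : tame F -> tame G -> tame (fun p => F p + G p).
Proof.
move=> [mF [M FM]] [mG [N GN]]; split; first exact: cmeasD.
exists (M + N) => p; rewrite mulrDl; apply: le_trans (le_normcD _ _) _.
exact: lerD.
Qed.

Lemma tameM F G (M : R) : tame F -> cmeas G ->
  (forall p, @diskD R p -> normc (G p) <= M) -> tame (fun p => F p * G p).
Proof.
move=> [mF [N FN]] mG GM; split; first exact: cmeasM.
exists (N * M) => p; rewrite Normc.normcM.
have := FN p; rewrite indicE; case: (boolP (p \in _)) => [pD|pD] /=.
  rewrite !mulr1 => h; apply: ler_pM => //; try exact: normc_ge0.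
  by apply: GM; rewrite inE in pD.
rewrite !mulr0 => h; have -> : normc (F p) = 0 by apply/eqP; rewrite eq_le h normc_ge0.
by rewrite mul0r.
Qed.

Lemma tameZ (z : R[i]) F : tame F -> tame (fun p => z * F p).
Proof.
move=> tF; have [mF BF] : tame (fun p => F p * z).
  by apply: (tameM (M := normc z)) => //; exact: cmeas_cst.
have E : (fun p => z * F p) = (fun p => F p * z) by apply/funext => p; rewrite mulrC.
by rewrite E.
Qed.

Lemma cintD F G : tame F -> tame G ->
  cint (fun p => F p + G p) = cint F + cint G.
Proof.
move=> /tame_integrable[F1 F2] /tame_integrable[G1 G2].
rewrite /cint; apply/eqP; rewrite eq_complex /=; apply/andP; split; apply/eqP.
  by under eq_Rintegral do rewrite complex_ReD; rewrite RintegralD.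
by under eq_Rintegral do rewrite complex_ImD; rewrite RintegralD.
Qed.

Lemma cintZ (z : R[i]) F : tame F -> cint (fun p => z * F p) = z * cint F.
Proof.
move=> /tame_integrable[F1 F2].
case: z => x y; rewrite /cint; apply/eqP; rewrite eq_complex /=; apply/andP; split;
  apply/eqP.
  under eq_Rintegral do rewrite complex_ReM /=.
  by rewrite RintegralB// ?RintegralZl//; exact: integrable_EFinZl.
under eq_Rintegral do rewrite complex_ImM /=.
by rewrite RintegralD// ?RintegralZl//; exact: integrable_EFinZl.
Qed.

Lemma cint0 : cint (fun=> 0) = 0.
Proof. by rewrite /cint /Rintegral /= !integral0. Qed.

Lemma tame0 : tame (fun=> 0).
Proof. by split; [exact: cmeas_cst | exists 0 => p; rewrite mul0r Normc.normc0]. Qed.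

Lemma tame_sum (n : nat) (F : nat -> RR -> R[i]) : (forall i, tame (F i)) ->
  tame (fun p => \sum_(i < n) F i p).
Proof.
move=> tF; elim: n => [|n IH].
  have -> : (fun p => \sum_(i < 0) F i p) = (fun=> 0) by apply/funext => p;
    rewrite big_ord0.
  exact: tame0.
have -> : (fun p => \sum_(i < n.+1) F i p) = (fun p => \sum_(i < n) F i p + F n p).
  by apply/funext => p; rewrite big_ord_recr.
exact: tameD.
Qed.

Lemma cint_sum (n : nat) (F : nat -> RR -> R[i]) : (forall i, tame (F i)) ->
  cint (fun p => \sum_(i < n) F i p) = \sum_(i < n) cint (F i).
Proof.
move=> tF; elim: n => [|n IH].
  rewrite big_ord0 -[RHS]cint0; apply: eq_cint => p; by rewrite big_ord0.
rewrite big_ord_recr /= -IH -cintD//; last exact: tame_sum.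
by apply: eq_cint => p; rewrite big_ord_recr.
Qed.

(** The factor 2 comes from estimating real and imaginary parts separately; the bound only serves
    for error terms, where constants do not matter. *)
Lemma normc_cint_le F (A : set RR) (M : R) : measurable A -> (leb2 A < +oo)%E ->
  cmeas F -> (forall p, normc (F p) <= M * \1_A p) ->
  normc (cint F) <= 2 * (M * fine (leb2 A)).
Proof.
move=> mA Afin [F1 F2] FM; apply: le_trans (normc_le_ReIm _) _.
rewrite mulr2n mulrDl !mul1r; apply: lerD.
  by apply: Rintegral_dominated => // p; apply: le_trans (Re_le_normc _) (FM p).
by apply: Rintegral_dominated => // p; apply: le_trans (Im_le_normc _) (FM p).
Qed.

End complex_integral.

(** * The Beurling transform of a single shell *)

Section piece.
Variable R : realType.
Local Notation leb2 := (@leb2 R).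
Local Notation mR := (measurableTypeR R).
Local Notation RR := (mR * mR)%type.
Local Notation Re := complex.Re.
Local Notation Im := complex.Im.
Local Notation normc := Normc.normc.
Local Notation C := (real_complex R).

Definition annulus (a b : R) : set RR := nsq (R := R) @^-1` `[a, b[.

(* [a] and [b] bound the squared modulus. *)
Definition piece (a b : R) (h : nat) (p : RR) : R[i] :=
  if p \in annulus a b then ((to_C p)^*%C / to_C p) ^+ h else 0.

Lemma measurable_annulus a b : measurable (annulus a b).
Proof. exact: measurable_nsq_preimage. Qed.

Lemma normc_to_C (p : RR) : normc (to_C p) = Num.sqrt (nsq p).
Proof. by []. Qed.

Lemma to_C_neq0 a b (p : RR) : 0 < a -> annulus a b p -> to_C p != 0.
Proof.
move=> a0; rewrite /annulus /= in_itv /= => /andP[ap _]; apply/eqP => p0.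
have := lt_le_trans a0 ap;
  rewrite -[nsq p]sqr_sqrtr ?nsq_ge0// -normc_to_C p0 Normc.normc0.
by rewrite expr0n ltxx.
Qed.

Lemma normc_conj (z : R[i]) : normc (z^*)%C = normc z.
Proof. by case: z => x y; rewrite /= sqrrN. Qed.

Lemma piece_le a b h (p : RR) : 0 < a -> normc (piece a b h p) <= 1 * \1_(annulus a b)
  p.
Proof.
move=> a0; rewrite /piece indicE mul1r; case: (boolP (p \in _)) => [/set_mem pA|_].
  rewrite normcX Normc.normcM normc_conj Normc.normcV divff ?expr1n//.
  by apply/eqP => /Normc.eq0_normc /eqP; apply/negP/(to_C_neq0 a0 pA).
by rewrite Normc.normc0.
Qed.

Lemma cmeas_piece a b h : cmeas (piece a b h).
Proof.
apply: (cmeas_if (measurable_annulus a b)); apply: cmeasX; apply: cmeasM.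
  by apply: cmeas_conj; exact: cmeas_to_C.
by apply: cmeasV; exact: cmeas_to_C.
Qed.

Lemma annulus_sub_disk a b : b <= 1 -> annulus a b `<=` @diskD R.
Proof.
move=> b1 p; rewrite diskDE /annulus /= !in_itv /= => /andP[_ pb].
exact: lt_le_trans pb b1.
Qed.

Lemma indic_annulus_le a b (p : RR) : b <= 1 -> \1_(annulus a b) p <= \1_(@diskD R) p
  :> R.
Proof.
move=> b1; rewrite !indicE; case: (boolP (p \in _)) => // /set_mem pA.
by rewrite mem_set//; exact: annulus_sub_disk pA.
Qed.

Lemma tame_piece a b h : 0 < a -> b <= 1 -> tame (piece a b h).
Proof.
move=> a0 b1; split; first exact: cmeas_piece.
exists 1 => p; apply: le_trans (piece_le _ _ _ a0) _.
by rewrite !mul1r indic_annulus_le.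
Qed.

Section rotation.
Variables (c s : R).
Hypothesis cs : c ^+ 2 + s ^+ 2 = 1.
Local Notation e := (c +i* s)%C.
Local Notation e' := (c -i* s)%C.

Lemma unit_conjM : e' * e = 1.
Proof.
apply/eqP; rewrite eq_complex /=; apply/andP; split; apply/eqP; last by ring.
by rewrite -cs; ring.
Qed.

Lemma unit_neq0 : e != 0.
Proof. by apply/eqP => e0; have := unit_conjM; rewrite e0 mulr0 => /esym/eqP;
  rewrite oner_eq0. Qed.

Lemma unit_inv : e^-1 = e'.
Proof. by rewrite -[LHS]mul1r -unit_conjM mulfK// unit_neq0. Qed.

Lemma nsq_planar_rot (p : RR) : nsq (planar_rot c s p) = nsq p.
Proof.
rewrite /nsq /planar_rot /=; transitivity ((c ^+ 2 + s ^+ 2) * (p.1 ^+ 2 + p.2 ^+ 2));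
  first by ring.
by rewrite cs mul1r.
Qed.

Lemma to_C_planar_rot (p : RR) : to_C (planar_rot c s p) = e * to_C p.
Proof.
by rewrite /to_C /planar_rot; apply/eqP; rewrite eq_complex /=; apply/andP; split;
  apply/eqP => //; ring.
Qed.

(** Rotating w by the unit e multiplies conj w / w by conj e / e, which is the square of conj e. *)
Lemma piece_planar_rot a b h (p : RR) :
  piece a b h (planar_rot c s p) = e' ^+ (2 * h) * piece a b h p.
Proof.
rewrite /piece (_ : (planar_rot c s p \in annulus a b) = (p \in annulus a b));
  last first.
  by apply/idP/idP => /set_mem; rewrite /annulus /= => H; apply/mem_set; move: H;
    rewrite /annulus /= nsq_planar_rot.
case: ifP => _; last by rewrite mulr0.
rewrite to_C_planar_rot rmorphM /= invfM unit_inv exprM -exprMn; congr (_ ^+ h).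
by rewrite expr2; ring.
Qed.

End rotation.

Lemma cos_sin_exp (t : R) n :
  (cos t +i* sin t)%C ^+ n = (cos (n%:R * t) +i* sin (n%:R * t))%C.
Proof.
elim: n => [|n IH]; first by rewrite expr0 mul0r cos0 sin0.
rewrite exprS IH -natr1 mulrDl mul1r cosD sinD.
by apply/eqP; rewrite eq_complex /=; apply/andP; split; apply/eqP; ring.
Qed.

Lemma exists_unit_expN1 n : (0 < n)%N ->
  exists c s : R, c ^+ 2 + s ^+ 2 = 1 /\ (c +i* s)%C ^+ n = -1.
Proof.
move=> n0; exists (cos (pi / n%:R)), (sin (pi / n%:R)); split; first exact: cos2Dsin2.
rewrite cos_sin_exp mulrC divfK ?pnatr_eq0 -?lt0n// cospi sinpi.
by apply/eqP; rewrite eq_complex /= oppr0 !eqxx.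
Qed.

Lemma normc_to_C_le1 (p : RR) : @diskD R p -> normc (to_C p) <= 1.
Proof.
move=> pD; have : nsq p < 1 by move: pD; rewrite diskDE /= in_itv.
by move=> /ltW p1; rewrite normc_to_C -[leRHS]sqrtr1 ler_wsqrtr.
Qed.

Lemma tame_piece_pow a b h j : 0 < a -> b <= 1 ->
  tame (fun p => piece a b h p * to_C p ^+ j).
Proof.
move=> a0 b1; apply: (tameM (M := 1)); first exact: tame_piece.
  by apply: cmeasX; exact: cmeas_to_C.
move=> p /normc_to_C_le1 p1; rewrite normcX exprn_ile1//; exact: normc_ge0.
Qed.

(* A rotation by a root of -1 multiplies the moment by -1. *)
Lemma moment_eq0 a b h j : 0 < a -> b <= 1 -> j != (2 * h)%N ->
  cint (fun p => piece a b h p * to_C p ^+ j) = 0.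
Proof.
move=> a0 b1 jh; set M := cint _.
have tF := tame_piece_pow h j a0 b1.
have Mrot c s : c ^+ 2 + s ^+ 2 = 1 ->
    M = (c -i* s)%C ^+ (2 * h) * (c +i* s)%C ^+ j * M.
  move=> cs; rewrite {1}/M -(cint_planar_rot cs tF.1) /M -cintZ//.
  by apply: eq_cint => p; rewrite piece_planar_rot// to_C_planar_rot exprMn; ring.
suff : M = - M by move=> /eqP; rewrite -subr_eq0 opprK -mulr2n mulrn_eq0 /= => /eqP.
move: jh; rewrite neq_ltn => /orP[jh|jh].
  have [c [s [cs e1]]] := exists_unit_expN1 (n := 2 * h - j) ltac:(by rewrite subn_gt0).
  (* For j < 2h the rotation runs in the opposite sense, so that the surplus factor is the power 2h
     - j of the root itself and not of its conjugate. *)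
  have cs' : c ^+ 2 + (- s) ^+ 2 = 1 by rewrite sqrrN.
  rewrite {1}(Mrot _ _ cs') opprK -(subnK (ltnW jh)) exprD e1 mulN1r mulNr -exprMn.
  by rewrite [X in X ^+ j]mulrC unit_conjM// expr1n mulNr mul1r.
have [c [s [cs e1]]] := exists_unit_expN1 (n := j - 2 * h) ltac:(by rewrite subn_gt0).
rewrite {1}(Mrot _ _ cs) -(subnKC (ltnW jh)) exprD e1 mulrA -exprMn unit_conjM// expr1n.
by rewrite mul1r mulN1r.
Qed.

Lemma mul_conjc (p : RR) : (to_C p)^*%C * to_C p = (nsq p)%:C%C.
Proof.
by apply/eqP; rewrite eq_complex /= /nsq; apply/andP; split; apply/eqP; ring.
Qed.

(** On the annulus (conj w / w)^h w^(2h) = (w conj w)^h: the phases cancel and a radial integral is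
    left. *)
Lemma moment_diag a b h : 0 < a -> a <= b ->
  cint (fun p => piece a b h p * to_C p ^+ (2 * h)) =
  (pi * (b ^+ h.+1 - a ^+ h.+1) / h.+1%:R)%:C%C.
Proof.
move=> a0 ab.
rewrite (@eq_cint _ _ (fun p => ((fun p => nsq p ^+ h) \_ (annulus a b) p)%:C%C));
  last first.
  move=> p; rewrite /piece patchE; case: ifPn => [/set_mem pA|]; last by rewrite mul0r.
  have w0 := to_C_neq0 a0 pA.
  have -> : (nsq p ^+ h)%:C%C = ((to_C p)^*%C * to_C p) ^+ h by rewrite mul_conjc
    rmorphXn.
  rewrite exprM -exprMn; congr (_ ^+ h).
  by rewrite expr2 mulrA divfK.
rewrite /cint; apply/eqP; rewrite eq_complex /=; apply/andP; split; apply/eqP;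
  last first.
  by rewrite /Rintegral integral0_eq.
rewrite -Rintegral_mkcond /Rintegral leb2_radial_integral//.
by rewrite (ltW a0).
Qed.

(** * The transform outside the disk, reduced to the positive real axis *)

Lemma le_normc_sub (z : R[i]) (r : R) (p : RR) : normc z = r -> @diskD R p ->
  r - 1 <= normc (z - to_C p).
Proof.
move=> zr /normc_to_C_le1 p1; rewrite lerBlDr -zr -{1}[z](subrK (to_C p)).
by apply: le_trans (le_normcD _ _) _; rewrite lerD2l.
Qed.

Lemma kernel_le (z : R[i]) (r : R) (p : RR) : 1 < r -> normc z = r -> @diskD R p ->
  normc ((z - to_C p) ^+ 2)^-1 <= ((r - 1) ^+ 2)^-1.
Proof.
move=> r1 zr pD; have h := le_normc_sub zr pD.
have r0 : 0 < r - 1 by rewrite subr_gt0.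
rewrite Normc.normcV normcX lef_pV2 ?posrE ?exprn_gt0 ?(lt_le_trans r0)//.
by rewrite ler_sqr ?nnegrE ?(ltW r0)// (le_trans (ltW r0)).
Qed.

Lemma cmeas_kernel (z : R[i]) : cmeas (fun p => ((z - to_C p) ^+ 2)^-1).
Proof.
apply: cmeasV; apply: cmeasX; apply: cmeasB; [exact: cmeas_cst | exact: cmeas_to_C].
Qed.

Lemma tame_kernel (z : R[i]) (r : R) (F : RR -> R[i]) : 1 < r -> normc z = r ->
  tame F -> tame (fun p => F p / (z - to_C p) ^+ 2).
Proof.
move=> r1 zr tF; apply: (tameM (M := ((r - 1) ^+ 2)^-1)) => //.
  exact: cmeas_kernel.
by move=> p; exact: kernel_le.
Qed.

(** In the exponent, 2h comes from the phase of the piece and 2 from the kernel, once the variable w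
    is rotated along with z. *)
Lemma beurling_piece_rot a b h (r c s : R) : 0 < a -> b <= 1 -> 1 < r ->
  c ^+ 2 + s ^+ 2 = 1 ->
  beurling (piece a b h) ((r * c) +i* (r * s))%C =
  (c -i* s)%C ^+ (2 * h + 2) * beurling (piece a b h) r%:C%C.
Proof.
move=> a0 b1 r1 cs; rewrite !beurlingE mulrCA; congr (_ * _).
have -> : ((r * c) +i* (r * s))%C = (c +i* s)%C * r%:C%C.
  by apply/eqP; rewrite eq_complex /=; apply/andP; split; apply/eqP; ring.
have nr : normc r%:C%C = r by rewrite normc_real gtr0_norm// (lt_trans ltr01).
rewrite -cintZ; last by apply: tame_kernel nr _ => //; exact: tame_piece.
rewrite -(cint_planar_rot cs); last first.
  by apply: cmeasM; [exact: cmeas_piece | exact: cmeas_kernel].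
apply: eq_cint => p; rewrite piece_planar_rot// to_C_planar_rot -mulrBr exprMn invfM
  -exprVn unit_inv//.
by rewrite exprD; ring.
Qed.

Lemma real_complexM (x y : R) : (x * y)%:C%C = x%:C%C * y%:C%C.
Proof. exact: rmorphM. Qed.
Lemma real_complexV (x : R) : (x^-1)%:C%C = (x%:C%C)^-1.
Proof. exact: fmorphV. Qed.
Lemma real_complexX (x : R) n : (x ^+ n)%:C%C = x%:C%C ^+ n.
Proof. exact: rmorphXn. Qed.
Lemma real_complexn n : (n%:R : R)%:C%C = n%:R.
Proof. exact: rmorph_nat. Qed.

(** With q = w / r this is the finite sum of (j + 1) q^j over j < J, equal to (1 - (J + 1) q^J + J
    q^(J+1)) / (1 - q)^2; it is an algebraic identity and involves no convergence. *)
Lemma kernel_expansion (r w : R[i]) J : r != 0 -> r - w != 0 ->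
  ((r - w) ^+ 2)^-1 = \sum_(j < J) (j.+1%:R / r ^+ j.+2 * w ^+ j) +
    (w / r) ^+ J * (J.+1%:R - J%:R * (w / r)) / (r - w) ^+ 2.
Proof.
move=> r0 rw; elim: J => [|J IH].
  by rewrite big_ord0 add0r expr0 mul0r subr0 mul1r mul1r.
rewrite [LHS]IH big_ord_recr /= -addrA; congr (_ + _).
rewrite !exprMn !exprVn !exprS -(natr1 J.+1) -(natr1 J).
by field; rewrite r0 rw expf_neq0.
Qed.

(** At J = 2n the power r^J = (r^n)^2 is at least (n (r - 1))^2, which is quadratic in n, whereas
    the right-hand side is at most 5 K n; a positive D is refuted by a large n. *)
Lemma exp_dominates_linear (r D K : R) n0 : 1 < r -> 0 <= D -> 0 <= K ->
  (forall J, (n0 < J)%N -> D * r ^+ J <= K * (2 * J%:R + 1)) -> D = 0.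
Proof.
move=> r1 D0 K0 H; apply/eqP; rewrite eq_le D0 andbT leNgt; apply/negP => Dp.
set d := r - 1; have d0 : 0 < d by rewrite subr_gt0.
have bern n : n%:R * d <= r ^+ n.
  elim: n => [|n IH]; first by rewrite mul0r expr0.
  have r1n : 1 <= r ^+ n by rewrite exprn_ege1// ltW.
  have -> : r = 1 + d by rewrite /d; ring.
  rewrite exprS -natr1 mulrDl mul1r mulrDl mul1r; apply: lerD.
    by move: IH; rewrite (_ : 1 + d = r)// /d; ring.
  by rewrite ler_peMr ?(ltW d0)// (_ : 1 + d = r)// /d; ring.
have Dd : 0 < D * d ^+ 2 by rewrite mulr_gt0// exprn_gt0.
pose n := maxn n0.+1 (Num.truncn (5 * K / (D * d ^+ 2))).+1.
have nn : 5 * K / (D * d ^+ 2) < n%:R.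
  apply: (lt_le_trans (truncnS_gt _)); first by rewrite ler_nat leq_maxr.
have n1 : (n0 < n)%N by exact: leq_maxl.
have n1' : 1 <= n%:R :> R by rewrite ler1n (leq_trans _ n1).
have := H (2 * n)%N ltac:(by rewrite (leq_trans n1)// leq_pmull).
rewrite exprM exprAC => HH.
have b2 : (n%:R * d) ^+ 2 <= (r ^+ n) ^+ 2.
  by rewrite ler_sqr ?nnegrE ?mulr_ge0 ?(ltW d0)// ?exprn_ge0// ltW// (lt_trans ltr01).
have : D * (n%:R * d) ^+ 2 <= K * (5 * n%:R).
  apply: le_trans (_ : D * (r ^+ n) ^+ 2 <= _); first by rewrite ler_wpM2l.
  apply: le_trans HH _; rewrite ler_wpM2l// natrM; lra.
rewrite ltr_pdivrMr// in nn.
have -> : D * (n%:R * d) ^+ 2 = n%:R * (n%:R * (D * d ^+ 2)) by ring.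
have -> : K * (5 * n%:R) = n%:R * (5 * K) by ring.
by rewrite ler_pM2l ?(lt_le_trans ltr01)// leNgt nn.
Qed.

(** Once J > 2h, the main part of the expansion integrates to the single term j = 2h, whatever J is.
    The difference of the two sides is thus the integrated remainder for every such J; being at most
    a multiple of (2J + 1) / r^J, it is 0. *)
Lemma cint_piece_kernel a b h (r : R) : 0 < a -> a <= b -> b <= 1 -> 1 < r ->
  cint (fun p => piece a b h p / (r%:C%C - to_C p) ^+ 2) =
  ((2 * h).+1%:R / r ^+ (2 * h).+2 * (pi * (b ^+ h.+1 - a ^+ h.+1) / h.+1%:R))%:C%C.
Proof.
move=> a0 ab b1 r1; have r0 : 0 < r by rewrite (lt_trans ltr01).
have nr : normc r%:C%C = r by rewrite normc_real gtr0_norm.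
have rc0 : r%:C%C != 0 by rewrite eq_complex /= eqxx andbT gt_eqF.
set I := cint _; set V := (_ * _)%:C%C.
apply/eqP; rewrite -subr_eq0; apply/eqP/Normc.eq0_normc.
pose K := 2 * (((r - 1) ^+ 2)^-1 * fine (leb2 (@diskD R))).
apply: (@exp_dominates_linear r _ K (2 * h)) => //; first exact: normc_ge0.
  by rewrite !mulr_ge0// ?invr_ge0 ?sqr_ge0// fine_ge0.
move=> J hJ.
pose rem p := piece a b h p * ((to_C p / r%:C%C) ^+ J *
  (J.+1%:R - J%:R * (to_C p / r%:C%C)) / (r%:C%C - to_C p) ^+ 2).
have crem : cmeas rem.
  apply: cmeasM; first exact: cmeas_piece.
  apply: cmeasM; last exact: cmeas_kernel.
  have cw : cmeas (fun p => to_C p / r%:C%C).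
    by apply: cmeasM; [exact: cmeas_to_C | exact: cmeas_cst].
  apply: cmeasM; first exact: cmeasX.
  apply: cmeasB; first exact: cmeas_cst.
  by apply: cmeasM => //; exact: cmeas_cst.
have nrem p : normc (rem p) <= ((2 * J%:R + 1) / r ^+ J * ((r - 1) ^+ 2)^-1) *
  \1_(@diskD R) p.
  have := piece_le b h p a0; rewrite mul1r => hp.
  rewrite /rem Normc.normcM; have := indic_annulus_le a p b1.
  rewrite !indicE in hp *; case: (boolP (p \in @diskD R)) => [/set_mem pD|_] /= hA;
    last first.
    have -> : normc (piece a b h p) = 0.
      apply/eqP; rewrite eq_le normc_ge0 andbT.
      exact: le_trans hp hA.
    by rewrite mul0r mulr0.
  rewrite mulr1 -[leRHS]mul1r; apply: ler_pM; rewrite ?normc_ge0 ?(le_trans hp)//.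
  rewrite Normc.normcM; apply: ler_pM; rewrite ?normc_ge0//; last exact: kernel_le.
  have nw : normc (to_C p / r%:C%C) <= r^-1.
    rewrite Normc.normcM Normc.normcV nr ler_piMl ?invr_ge0 ?(ltW r0)//.
    exact: normc_to_C_le1.
  rewrite Normc.normcM mulrC; apply: ler_pM; rewrite ?normc_ge0//.
    apply: le_trans (le_normcD _ _) _; rewrite normcN Normc.normcM.
    have nn n : normc n%:R = n%:R :> R by rewrite -(rmorph_nat C) normc_real ger0_norm.
    rewrite !nn -natr1.
    have : J%:R * normc (to_C p / r%:C%C) <= J%:R :> R.
      rewrite ler_piMr// (le_trans nw)// invf_le1//; exact: ltW.
    by lra.
  by rewrite normcX -exprVn lerXn2r ?nnegrE ?normc_ge0// invr_ge0 ltW.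
have trem : tame rem by split => //; eexists; exact: nrem.
have IE : I = V + cint rem.
  pose T j p := (j.+1%:R / r%:C%C ^+ j.+2) * (piece a b h p * to_C p ^+ j).
  have tT j : tame (T j) by apply: tameZ; exact: tame_piece_pow.
  have -> : I = cint (fun p => \sum_(j < J) T j p + rem p).
    apply: eq_cint => p; rewrite /T /rem /piece; case: ifPn => [/set_mem pA|_];
      last first.
      by rewrite !mul0r addr0 big1// => j _; rewrite mul0r mulr0.
    have pD := annulus_sub_disk b1 pA.
    have rw0 : r%:C%C - to_C p != 0.
      apply/eqP => e0; have := le_normc_sub nr pD; rewrite e0 Normc.normc0 leNgt.
      by rewrite subr_gt0 r1.
    rewrite [in LHS](kernel_expansion J rc0 rw0) mulrDr mulr_sumr; congr (_ + _).
    by apply: eq_bigr => j _; ring.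
  transitivity (cint (fun p => \sum_(j < J) T j p) + cint rem).
    exact: (cintD (tame_sum J tT) trem).
  rewrite (cint_sum J tT); congr (_ + _).
  (* [hJ] places the index 2h in the range of summation; all other moments vanish. *)
  rewrite (bigD1 (Ordinal hJ))//= big1 ?addr0.
    rewrite /T cintZ; last exact: tame_piece_pow.
    by rewrite moment_diag// /V [RHS]real_complexM [X in _ = X * _]real_complexM
      real_complexV real_complexX real_complexn.
  move=> j jh; rewrite /T cintZ; last exact: tame_piece_pow.
  by rewrite moment_eq0// mulr0.
have := normc_cint_le (@measurable_diskD R) (@leb2_diskD_lty R) crem nrem.
rewrite IE addrAC subrr add0r => hh.
apply: le_trans (ler_wpM2r _ hh) _; first by rewrite exprn_ge0// ltW.
rewrite le_eqVlt; apply/orP; left; apply/eqP; rewrite /K.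
have rJ : r ^+ J != 0 by rewrite expf_neq0// gt_eqF.
have rm : r - 1 != 0 by rewrite subr_eq0 gt_eqF.
by field; rewrite rJ rm.
Qed.

Lemma beurling_piece a b h (r c s : R) : 0 < a -> a <= b -> b <= 1 -> 1 < r ->
  c ^+ 2 + s ^+ 2 = 1 ->
  beurling (piece a b h) ((r * c) +i* (r * s))%C =
  (c -i* s)%C ^+ (2 * h + 2) *
  (- ((2 * h).+1%:R / h.+1%:R * (b ^+ h.+1 - a ^+ h.+1) / r ^+ (2 * h + 2)))%:C%C.
Proof.
move=> a0 ab b1 r1 cs; rewrite beurling_piece_rot//; congr (_ * _).
rewrite beurlingE cint_piece_kernel// -rmorphM /=; congr (_%:C)%C.
rewrite addn2; have r0 : r ^+ (2 * h).+2 != 0 by rewrite expf_neq0// gt_eqF// (lt_trans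
  ltr01).
have pi0 : pi != 0 :> R by rewrite gt_eqF// pi_gt0.
have k0 : h.+1%:R != 0 :> R by rewrite pnatr_eq0.
move: (b ^+ h.+1) (a ^+ h.+1) (r ^+ (2 * h).+2) r0 (h.+1%:R) k0 ((2 * h).+1%:R) (pi)
  pi0.
move=> B A q q0 k k0 l P P0; field. by rewrite ?q0 ?k0 ?P0.
Qed.

End piece.

(** * Mean squares of trigonometric polynomials *)

(** The integral of a nonnegative function is the supremum over the simple functions below it, which
    is monotone for arbitrary functions. This bounds the square mean of the transform from below
    without a study of its measurability in the angle. *)
Lemma ge0_le_integral_nomeas d (T : measurableType d) (R : realType)
    (mu : {measure set T -> \bar R}) (D : set T) (f g : T -> \bar R) :
  (forall x, D x -> (0 <= f x)%E) -> (forall x, D x -> (f x <= g x)%E) ->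
  (\int[mu]_(x in D) f x <= \int[mu]_(x in D) g x)%E.
Proof.
move=> f0 fg; rewrite integral_mkcond [leRHS]integral_mkcond.
have g0 x : D x -> (0 <= g x)%E by move=> Dx; exact: le_trans (f0 x Dx) (fg x Dx).
have rf0 x : (0 <= (f \_ D) x)%E by exact: erestrict_ge0.
have rg0 x : (0 <= (g \_ D) x)%E by exact: erestrict_ge0.
rewrite !ge0_integralTE//; apply: le_ereal_sup => _ [h /= hf <-].
by exists h => // x; apply: le_trans (hf x) _; exact: lee_restrict.
Qed.

Section trigonometric_polynomial.
Variable R : realType.
Local Notation lam := (@lebesgue_measure R).

Definition cos_primitive (nu t : R) : R := if nu == 0 then t else sin (nu * t) / nu.

Lemma is_derive_cos_primitive (nu t : R) :
  is_derive t 1 (cos_primitive nu) (cos (nu * t)).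
Proof.
rewrite /cos_primitive; have [->|nu0] := eqVneq nu 0.
  by rewrite mul0r cos0; exact: is_derive_id.
rewrite (_ : (fun _ => _) = nu^-1 \*: (sin \o (nu \*: (id : R -> R)))); last first.
  by apply/funext => u; rewrite /= mulrC.
by apply: is_derive_eq; rewrite /GRing.scale /=; field.
Qed.

Lemma cos_primitive0 (nu : R) : cos_primitive nu 0 = 0.
Proof. by rewrite /cos_primitive; case: ifP => // _; rewrite mulr0 sin0 mul0r. Qed.

Lemma sin_nat2pi n : sin (n%:R * (2 * pi)) = 0 :> R.
Proof.
elim: n => [|n IH]; first by rewrite mul0r sin0.
by rewrite -natr1 mulrDl mul1r [X in _ + X]mulr_natl sinD2pi.
Qed.

Lemma cos_primitive_2pi (n m : nat) :
  cos_primitive (n%:R - m%:R) (2 * pi) = if n == m then 2 * pi else 0.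
Proof.
rewrite /cos_primitive subr_eq0 eqr_nat; case: ifP => // _.
by rewrite mulrBl sinB !sin_nat2pi mul0r mulr0 subrr mul0r.
Qed.

Lemma is_derive_sum_ord n (h : 'I_n -> R -> R) (dh : 'I_n -> R) (t : R) :
  (forall i, is_derive t 1 (h i) (dh i)) ->
  is_derive t 1 (fun u => \sum_(i < n) h i u) (\sum_(i < n) dh i).
Proof.
move=> H; rewrite (_ : (fun u => _) = \sum_(i < n) h i); first exact: is_derive_sum.
by apply/funext => u; rewrite fct_sumE.
Qed.

Variables (m : nat) (c : nat -> R) (N : nat -> nat).
Hypothesis Ninj : injective N.

Definition trig_sqnorm (t : R) : R :=
  (\sum_(k < m) c k * cos ((N k)%:R * t)) ^+ 2 +
  (\sum_(k < m) c k * sin ((N k)%:R * t)) ^+ 2.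

Lemma trig_sqnormE (t : R) : trig_sqnorm t =
  \sum_(k < m) \sum_(l < m) c k * c l * cos (((N k)%:R - (N l)%:R) * t).
Proof.
rewrite /trig_sqnorm !expr2 !mulr_suml -big_split /=; apply: eq_bigr => k _.
rewrite !mulr_sumr -big_split /=; apply: eq_bigr => l _.
by rewrite mulrBl cosB; ring.
Qed.

Lemma continuous_trig_sum (f : R -> R) : continuous f ->
  continuous (fun t : R => \sum_(k < m) c k * f ((N k)%:R * t)).
Proof.
move=> cf t; apply: cvg_big => [|k _]; first exact: add_continuous.
apply: cvgM; first exact: cvg_cst.
apply: (@continuous_comp _ _ _ (fun t : R => (N k)%:R * t) f); last exact: cf.
exact: mulrl_continuous.
Qed.

Lemma continuous_trig_sqnorm : continuous trig_sqnorm.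
Proof.
have cC := continuous_trig_sum (@continuous_cos R).
have cS := continuous_trig_sum (@continuous_sin R).
by move=> t; apply: (cvgD (cvgM (cC t) (cC t)) (cvgM (cS t) (cS t))).
Qed.

(** Parseval's identity: off the diagonal of the double sum, injectivity of [N] makes the frequency
    a nonzero integer and the term integrates to 0 over the period. The constant [eta] leaves room
    for the truncation error. *)
Lemma integral_trig_sqnorm (eta : R) :
  (\int[lam]_(t in `[0%R, (2 * pi)%R]) (trig_sqnorm t - eta)%:E =
   (2 * pi * (\sum_(k < m) c k ^+ 2 - eta))%:E)%E.
Proof.
pose A (t : R) := \sum_(k < m) \sum_(l < m) c k * c l * cos_primitive ((N k)%:R - (N
  l)%:R) t.
pose G (t : R) := A t - eta * t.
have dA (t : R) : is_derive t 1 A (trig_sqnorm t).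
  rewrite trig_sqnormE; apply: is_derive_sum_ord => k; apply: is_derive_sum_ord => l.
  have := is_derive_cos_primitive ((N k)%:R - (N l)%:R) t => d.
  by apply: (@is_deriveZ _ _ _ _ (c k * c l)).
have dG (t : R) : is_derive t 1 G (trig_sqnorm t - eta).
  have de : is_derive t 1 (fun t : R => eta * t) eta.
    by apply: is_derive_eq; rewrite /GRing.scale /=; ring.
  exact: is_deriveB.
have cG : continuous G.
  by move=> t; apply: differentiable_continuous; apply/derivable1_diffP;
    apply: ex_derive.
rewrite (@continuous_FTC2 R _ G).
- rewrite -EFinB; congr EFin; rewrite /G /A.
  rewrite [X in _ - (X - _)]big1 ?mulr0; last first.
    by move=> k _; apply: big1 => l _; rewrite cos_primitive0 mulr0.
  rewrite (eq_bigr (fun k : 'I_m => c k ^+ 2 * (2 * pi))).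
    by rewrite -mulr_suml; ring.
  move=> k _; rewrite (bigD1 k)//= big1.
    by rewrite cos_primitive_2pi eqxx; ring.
  move=> l lk; rewrite cos_primitive_2pi ifF ?mulr0//.
  by apply/negP => /eqP /Ninj /ord_inj kl; move: lk; rewrite kl eqxx.
- by have := @pi_gt0 R; lra.
- apply: continuous_subspaceT => t; apply: cvgB;
  [exact: continuous_trig_sqnorm | exact: cvg_cst].
- by split; [move=> t _; apply: ex_derive | apply: cvg_at_right_filter;
  exact: cG | apply: cvg_at_left_filter; exact: cG].
- by move=> t _; rewrite derive1E; exact: derive_val.
Qed.

Lemma integral_ge_trig_sqnorm (eta : R) (g : R -> R) :
  (forall t, 0 <= g t) -> (forall t, trig_sqnorm t - eta <= g t) ->
  ((2 * pi * (\sum_(k < m) c k ^+ 2 - eta))%:E <=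
   \int[lam]_(t in `[0%R, (2 * pi)%R]) (g t)%:E)%E.
Proof.
move=> g0 hg; rewrite -integral_trig_sqnorm.
have ch : continuous (fun t => trig_sqnorm t - eta).
  by move=> t; apply: cvgB; [exact: continuous_trig_sqnorm | exact: cvg_cst].
(* The difference may be negative, while comparison with an arbitrary [g] needs a nonnegative lower
   function; its positive part is one, and is still continuous. *)
pose h t := Num.max (trig_sqnorm t - eta) 0.
have cmax : continuous h.
  by move=> t; exact: (@continuous_max _ _ (fun t : R => trig_sqnorm t - eta) (fun=>
    0) t (ch t) (@cst_continuous _ _ 0 t)).
apply: (@le_trans _ _ (\int[lam]_(t in `[0%R, (2 * pi)%R]) (h t)%:E)%E); last first.
  apply: ge0_le_integral_nomeas => t _; rewrite lee_fin;
    first by rewrite le_max lexx orbT.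
  by rewrite ge_max hg g0.
apply: le_integral => //.
- apply: continuous_compact_integrable; first exact: segment_compact.
  exact: continuous_subspaceT.
- apply: continuous_compact_integrable; first exact: segment_compact.
  exact: continuous_subspaceT.
- by move=> t _; rewrite lee_fin le_max lexx.
Qed.

End trigonometric_polynomial.

(** * The lacunary construction *)

Section construction.
Variable R : realType.
Local Notation leb2 := (@leb2 R).
Local Notation mR := (measurableTypeR R).
Local Notation RR := (mR * mR)%type.
Local Notation Re := complex.Re.
Local Notation Im := complex.Im.
Local Notation normc := Normc.normc.
Local Notation lam := (@lebesgue_measure R).

Variable x : R.
Hypotheses (x0 : 0 < x) (x1 : x < 1).

(* The squared radius a_k ^ 2 of the header. *)
Definition radius2 (k : nat) : R := expR (2 * ln x / 20%:R ^+ k).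

Definition half_freq (k : nat) : nat := (10 * 20 ^ k).-1.

Lemma half_freqS k : (half_freq k).+1 = (10 * 20 ^ k)%N.
Proof. by rewrite /half_freq prednK// muln_gt0 expn_gt0. Qed.

Lemma radius2_gt0 k : 0 < radius2 k.
Proof. exact: expR_gt0. Qed.

Lemma lnx_lt0 : ln x < 0.
Proof. by rewrite ln_lt0// x0. Qed.

Lemma radius2_lt1 k : radius2 k < 1.
Proof.
rewrite /radius2 expR_lt1 pmulr_llt0 ?invr_gt0 ?exprn_gt0//.
by rewrite pmulr_rlt0// lnx_lt0.
Qed.

Lemma radius2_le k l : (k <= l)%N -> radius2 k <= radius2 l.
Proof.
move=> kl; rewrite /radius2 ler_expR ler_nM2l ?pmulr_rlt0 ?lnx_lt0//.
rewrite lef_pV2 ?posrE ?exprn_gt0//.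
by apply: ler_weXn2l => //; rewrite ler1n.
Qed.

(** The radii are made for this identity and the next: the jump b^(h+1) - a^(h+1) in the moment is x
    - x^20 on every shell. *)
Lemma radius2_expS k : radius2 k.+1 ^+ (half_freq k).+1 = x.
Proof.
rewrite half_freqS /radius2 -expRM_natl natrM natrX exprS -[RHS]lnK ?posrE//.
congr expR; have : 20%:R ^+ k != 0 :> R by rewrite expf_neq0// pnatr_eq0.
by move: (20%:R ^+ k) => y y0; field.
Qed.

Lemma radius2_exp k : radius2 k ^+ (half_freq k).+1 = x ^+ 20.
Proof.
rewrite half_freqS /radius2 -expRM_natl natrM natrX -[in RHS](@lnK R x) ?posrE//
  -expRM_natl.
congr expR; have : 20%:R ^+ k != 0 :> R by rewrite expf_neq0// pnatr_eq0.
by move: (20%:R ^+ k) => y y0; field.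
Qed.

Lemma radius2_near1 (eta : R) : 0 < eta ->
  exists K0, forall K, (K0 <= K)%N -> 1 - radius2 K <= eta.
Proof.
move=> e0; pose C : R := - (2 * ln x).
have C0 : 0 < C by rewrite oppr_gt0 pmulr_rlt0// lnx_lt0.
exists (Num.truncn (C / eta)).+1 => K hK.
have yK : 0 < 20%:R ^+ K :> R by rewrite exprn_gt0.
have h1 : 1 - C / 20%:R ^+ K <= radius2 K.
  apply: le_trans (expR_ge1Dx _).
  by rewrite lerD2l /C mulNr opprK.
suff h2 : C / 20%:R ^+ K <= eta by lra.
rewrite ler_pdivrMr// mulrC -ler_pdivrMr//.
apply: le_trans (_ : K%:R <= _).
  apply/ltW/(lt_le_trans (truncnS_gt _)); by rewrite ler_nat.
by rewrite -natrX ler_nat ltnW// ltn_expl.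
Qed.

(** * The shells and the function mu *)

Definition shell_piece k : RR -> R[i] := piece (radius2 k) (radius2 k.+1) (half_freq k).
Definition shell k : set RR := annulus (radius2 k) (radius2 k.+1).

Lemma shellP k (p : RR) : shell k p <-> radius2 k <= nsq p < radius2 k.+1.
Proof. by rewrite /shell /annulus /= in_itv. Qed.

Lemma shell_lt K k (p : RR) : nsq p < radius2 K -> shell k p -> (k < K)%N.
Proof.
move=> pK /shellP/andP[kp _]; rewrite ltnNge; apply/negP => /radius2_le Kk.
by have := le_lt_trans (le_trans Kk kp) pK; rewrite ltxx.
Qed.

Lemma shell_ge K k (p : RR) : radius2 K <= nsq p -> shell k p -> (K <= k)%N.
Proof.
move=> pK /shellP/andP[_ kp]; rewrite leqNgt; apply/negP => /radius2_le Kk.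
by have := le_lt_trans (le_trans Kk pK) kp; rewrite ltxx.
Qed.

Lemma shell_inj k l (p : RR) : shell k p -> shell l p -> k = l.
Proof.
move=> kp lp; apply/eqP; rewrite eqn_leq.
move: (kp) => /shellP/andP[_ k2]; move: (lp) => /shellP/andP[_ l2].
apply/andP; split; rewrite -ltnS; [exact: shell_lt l2 kp | exact: shell_lt k2 lp].
Qed.

Lemma shell_piece_out k (p : RR) : ~ shell k p -> shell_piece k p = 0.
Proof. by move=> kp; rewrite /shell_piece /piece; case: ifPn => // /set_mem. Qed.

(** The shells are disjoint, so at most one index qualifies; where none does, the default index 0
    still gives the value 0, as p lies outside shell 0 as well. *)
Definition shell_mu (p : RR) : R[i] := shell_piece (xget 0%N [set k | shell k p]) p.

Definition shell_mu_sum (K : nat) (p : RR) : R[i] := \sum_(k < K) shell_piece k p.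

Lemma shell_mu_in k (p : RR) : shell k p -> shell_mu p = shell_piece k p.
Proof.
move=> kp; rewrite /shell_mu; case: xgetP => [l _ lp|/(_ k)//].
by rewrite (shell_inj kp lp).
Qed.

Lemma shell_mu_out (p : RR) : (forall k, ~ shell k p) -> shell_mu p = 0.
Proof. by move=> kp; apply: shell_piece_out. Qed.

Lemma shell_mu_sum_out K (p : RR) : (forall k,
  (k < K)%N -> ~ shell k p) -> shell_mu_sum K p = 0.
Proof. by move=> kp; rewrite /shell_mu_sum big1// => k _; apply/shell_piece_out/kp. Qed.

Lemma shell_mu_sum_in K k (p : RR) : (k < K)%N -> shell k p -> shell_mu_sum K p =
  shell_piece k p.
Proof.
move=> kK kp; rewrite /shell_mu_sum (bigD1 (Ordinal kK))//= big1 ?addr0// => l lk.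
apply: shell_piece_out => lp; move: lk; rewrite -val_eqE /= => /eqP; apply.
exact: shell_inj lp kp.
Qed.

Lemma shell_mu_sum_eq K (p : RR) : nsq p < radius2 K -> shell_mu_sum K p = shell_mu p.
Proof.
move=> pK; have [[k kp]|nk] := pselect (exists k, shell k p).
  by rewrite (shell_mu_in kp) (shell_mu_sum_in (shell_lt pK kp) kp).
rewrite shell_mu_out ?shell_mu_sum_out// => k; first by move=> _ kp; apply: nk;
  exists k.
by move=> kp; apply: nk; exists k.
Qed.

Lemma shell_lt1 k (p : RR) : shell k p -> nsq p < 1.
Proof. by move=> /shellP/andP[_ /lt_trans]; apply; exact: radius2_lt1. Qed.

Lemma shell_mu_sum_eq_ge1 K (p : RR) : 1 <= nsq p -> shell_mu_sum K p = shell_mu p.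
Proof.
move=> p1; have nk k : ~ shell k p by move=> /shell_lt1; rewrite ltNge p1.
by rewrite shell_mu_out// shell_mu_sum_out.
Qed.

Lemma tame_shell_piece k : tame (shell_piece k).
Proof. by apply: tame_piece; [exact: radius2_gt0 | exact/ltW/radius2_lt1]. Qed.

Lemma tame_shell_mu_sum K : tame (shell_mu_sum K).
Proof. exact: (tame_sum K tame_shell_piece). Qed.

Lemma shell_mu_sum_eventually (p : RR) : exists K0, forall K,
  (K0 <= K)%N -> shell_mu_sum K p = shell_mu p.
Proof.
have [p1|p1] := ltP (nsq p) 1; last by exists 0%N => K _; exact: shell_mu_sum_eq_ge1.
have e0 : 0 < (1 - nsq p) / 2 by rewrite divr_gt0// subr_gt0.
have [K0 HK0] := radius2_near1 e0.
exists K0 => K /HK0 h; apply: shell_mu_sum_eq; lra.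
Qed.

(** At each point the partial sums are eventually constant, so mu is a pointwise limit of measurable
    functions. *)
Lemma cmeas_shell_mu : cmeas shell_mu.
Proof.
have mS K : cmeas (shell_mu_sum K) by case: (tame_shell_mu_sum K).
have cvg_proj (f : R[i] -> R) (p : RR) : (fun K =>
  f (shell_mu_sum K p)) @ \oo --> f (shell_mu p).
  have [K0 HK0] := shell_mu_sum_eventually p.
  by apply: cvg_near_cst; exists K0 => // K /= /HK0 ->.
split.
  apply: (measurable_fun_cvg (h := fun K p => Re (shell_mu_sum K p))) => [K|p _].
    by case: (mS K).
  exact: cvg_proj.
apply: (measurable_fun_cvg (h := fun K p => Im (shell_mu_sum K p))) => [K|p _].
  by case: (mS K).
exact: cvg_proj.
Qed.

Lemma shell_mu_le_shell (p : RR) k : shell k p -> normc (shell_mu p) <= 1.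
Proof.
move=> kp; rewrite (shell_mu_in kp); apply: le_trans (piece_le _ _ _ (radius2_gt0 k)) _.
by rewrite mul1r indicE; case: (p \in _).
Qed.

Lemma shell_mu_le (p : RR) : normc (shell_mu p) <= 1 * \1_(@diskD R) p.
Proof.
have [[k kp]|nk] := pselect (exists k, shell k p).
  apply: le_trans (shell_mu_le_shell kp) _; rewrite mul1r indicE mem_set//.
  by rewrite diskDE /= in_itv /=; exact: shell_lt1 kp.
rewrite shell_mu_out ?Normc.normc0 ?mul1r ?indicE// => k kp; by apply: nk; exists k.
Qed.

Lemma shell_mu_tail_le K (p : RR) :
  normc (shell_mu p - shell_mu_sum K p) <= 1 * \1_(annulus (radius2 K) 1) p.
Proof.
have ge0 : 0 <= 1 * \1_(annulus (radius2 K) 1) p :> R by rewrite mul1r.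
have [pK|pK] := ltP (nsq p) (radius2 K).
  by rewrite (shell_mu_sum_eq pK) subrr Normc.normc0.
have [p1|p1] := ltP (nsq p) 1;
  last by rewrite (shell_mu_sum_eq_ge1 K p1) subrr Normc.normc0.
rewrite mul1r indicE mem_set; last by rewrite /annulus /= in_itv /= pK.
rewrite shell_mu_sum_out ?subr0; last first.
  by move=> k kK /(shell_ge pK); rewrite leqNgt kK.
have [[k kp]|nk] := pselect (exists k, shell k p); first exact: shell_mu_le_shell kp.
by rewrite shell_mu_out ?Normc.normc0// => k kp; apply: nk; exists k.
Qed.

Lemma leb2_annulus1 (a : R) : 0 <= a <= 1 -> leb2 (annulus a 1) = (pi * (1 - a))%:E.
Proof.
move=> /andP[a0 a1]; rewrite leb2_nsq//; last first.
  by move=> y /=; rewrite !in_itv /= => /andP[/(le_trans a0) ->].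
rewrite lebesgue_measure_itv /= lte_fin; case: ltP => [_|a1'].
  by rewrite -EFinB -EFinM.
by rewrite mule0 (_ : a = 1) ?subrr ?mulr0//; apply/eqP; rewrite eq_le a1.
Qed.

(** * Truncation to finitely many shells *)

Definition beurling_tail K (z : R[i]) : R[i] :=
  (- pi^-1)%:C%C * cint (fun w => (shell_mu w - shell_mu_sum K w) / (z - to_C w) ^+ 2).

Lemma tame_shell_mu_tail K : tame (fun w => shell_mu w - shell_mu_sum K w).
Proof.
split; first by apply: cmeasB; [exact: cmeas_shell_mu | case: (tame_shell_mu_sum K)].
exists 1 => p; apply: le_trans (shell_mu_tail_le K p) _.
by rewrite !mul1r indic_annulus_le.
Qed.

Lemma beurling_shell_mu K (z : R[i]) (r : R) : 1 < r -> normc z = r ->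
  beurling shell_mu z = \sum_(k < K) beurling (shell_piece k) z + beurling_tail K z.
Proof.
move=> r1 zr; rewrite beurlingE /beurling_tail.
have tk F : tame F -> tame (fun p => F p / (z - to_C p) ^+ 2) by move=> tF;
  exact: (tame_kernel r1 zr tF).
have -> : cint (fun w => shell_mu w / (z - to_C w) ^+ 2) =
    cint (fun w => \sum_(k < K) (shell_piece k w / (z - to_C w) ^+ 2)) +
    cint (fun w => (shell_mu w - shell_mu_sum K w) / (z - to_C w) ^+ 2).
  have tS : tame (fun w => \sum_(k < K) (shell_piece k w / (z - to_C w) ^+ 2)).
    by apply: (tame_sum K (F := fun k w => shell_piece k w / (z - to_C w) ^+ 2)) => k;
      exact: tk (tame_shell_piece k).
  rewrite -(cintD tS (tk _ (tame_shell_mu_tail K))).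
  apply: eq_cint => w; rewrite -mulr_suml -/(shell_mu_sum K w) -mulrDl; congr (_ / _).
  by rewrite addrC subrK.
rewrite mulrDr; congr (_ + _).
rewrite (cint_sum K (F := fun k w => shell_piece k w / (z - to_C w) ^+ 2));
  last by move=> k; exact: tk (tame_shell_piece k).
by rewrite mulr_sumr; apply: eq_bigr => k _.
Qed.

Lemma beurling_bound (F : RR -> R[i]) (A : set RR) (z : R[i]) (r : R) :
  1 < r -> normc z = r -> measurable A -> A `<=` @diskD R -> cmeas F ->
  (forall p, normc (F p) <= 1 * \1_A p) ->
  normc ((- pi^-1)%:C%C * cint (fun w => F w / (z - to_C w) ^+ 2)) <=
  2 * (pi^-1 * fine (leb2 A)) / (r - 1) ^+ 2.
Proof.
move=> r1 zr mA AD cF FA.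
have Afin : (leb2 A < +oo)%E.
  apply: le_lt_trans (@leb2_diskD_lty R); apply: le_measure; rewrite ?inE//.
  exact: measurable_diskD.
have cG : cmeas (fun w => F w / (z - to_C w) ^+ 2).
  by apply: cmeasM => //; exact: cmeas_kernel.
have GA p : normc (F p / (z - to_C p) ^+ 2) <= ((r - 1) ^+ 2)^-1 * \1_A p.
  rewrite Normc.normcM; have := FA p; rewrite indicE mul1r.
  case: (boolP (p \in A)) => [/set_mem pA|_] /= h.
    rewrite mulr1 -[leRHS]mul1r; apply: ler_pM; rewrite ?normc_ge0//.
    by apply: kernel_le => //; exact: AD.
  have -> : normc (F p) = 0 by apply/eqP; rewrite eq_le h normc_ge0.
  by rewrite mul0r mulr0.
have pi0 := @pi_gt0 R.
rewrite Normc.normcM normc_real normrN ger0_norm ?invr_ge0 ?(ltW pi0)//.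
have := normc_cint_le mA Afin cG GA.
rewrite -(ler_pM2l (x := pi^-1)) ?invr_gt0// => h; apply: le_trans h _.
by rewrite le_eqVlt; apply/orP; left; apply/eqP; ring.
Qed.

(** The tail of mu lives on an annulus of area pi (1 - [radius2 K]). At fixed r the bound tends to 0
    with growing K, so its blow-up as r tends to 1 does no harm. *)
Lemma beurling_tail_le K (z : R[i]) (r : R) : 1 < r -> normc z = r ->
  normc (beurling_tail K z) <= 2 * (1 - radius2 K) / (r - 1) ^+ 2.
Proof.
move=> r1 zr.
have -> : 1 - radius2 K = pi^-1 * fine (leb2 (annulus (radius2 K) 1)).
  rewrite leb2_annulus1 /=; last by rewrite (ltW (radius2_gt0 K)) ltW// radius2_lt1.
  by rewrite mulKf// gt_eqF// pi_gt0.
apply: beurling_bound => //; first exact: measurable_annulus.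
- by apply: annulus_sub_disk.
- by case: (tame_shell_mu_tail K).
- exact: shell_mu_tail_le.
Qed.

(** A crude bound at fixed r, used to pass from a small tail to a small difference of squared
    moduli. *)
Lemma beurling_shell_mu_le (z : R[i]) (r : R) : 1 < r -> normc z = r ->
  normc (beurling shell_mu z) <= 2 * (pi^-1 * fine (leb2 (@diskD R))) / (r - 1) ^+ 2.
Proof.
move=> r1 zr; rewrite beurlingE; apply: beurling_bound => //.
- exact: measurable_diskD.
- exact: cmeas_shell_mu.
- exact: shell_mu_le.
Qed.

(** * The square mean on a circle *)

Definition freq (k : nat) : nat := (2 * half_freq k + 2)%N.

Lemma freqE k : freq k = (20 ^ k.+1)%N.
Proof. by rewrite /freq addnC -mulnS half_freqS mulnA -expnS. Qed.

Lemma freq_inj : injective freq.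
Proof. by move=> k l; rewrite !freqE => /eqP; rewrite eqn_exp2l// => /eqP []. Qed.

Definition coef (r : R) (k : nat) : R :=
  (2 * half_freq k).+1%:R / (half_freq k).+1%:R * (x - x ^+ 20) / r ^+ freq k.

Lemma beurling_shell_piece k (r t : R) : 1 < r ->
  beurling (shell_piece k) ((r * cos t) +i* (r * sin t))%C =
  ((- (coef r k * cos ((freq k)%:R * t))) +i* (coef r k * sin ((freq k)%:R * t)))%C.
Proof.
move=> r1; rewrite /shell_piece beurling_piece//; last first.
- exact: cos2Dsin2.
- exact/ltW/radius2_lt1.
- exact: radius2_le.
- exact: radius2_gt0.
rewrite radius2_expS radius2_exp -/(freq k) -/(coef r k).
have -> : (cos t -i* sin t)%C = (cos (- t) +i* sin (- t))%C by rewrite cosN sinN.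
rewrite cos_sin_exp mulrN cosN sinN.
by apply/eqP; rewrite eq_complex /=; apply/andP; split; apply/eqP; ring.
Qed.

Lemma sqr_normc_sum_shell_piece K (r t : R) : 1 < r ->
  normc (\sum_(k < K) beurling (shell_piece k) ((r * cos t) +i* (r * sin t))%C) ^+ 2 =
  trig_sqnorm K (coef r) freq t.
Proof.
move=> r1; set P := \sum_(k < K) _.
have [PR PI] : Re P = - \sum_(k < K) coef r k * cos ((freq k)%:R * t) /\
    Im P = \sum_(k < K) coef r k * sin ((freq k)%:R * t).
  rewrite /P; elim: K {P} => [|K [IH1 IH2]]; first by rewrite !big_ord0 oppr0.
  rewrite !big_ord_recr /= complex_ReD complex_ImD IH1 IH2 beurling_shell_piece//=;
    split => //.
  by rewrite opprD.
rewrite -cnormE /cnorm sqr_sqrtr ?addr_ge0 ?sqr_ge0//.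
by rewrite PR PI sqrrN.
Qed.

(** For e > 0, the transform is truncated at some K >= m so large that the tail changes the integral
    by at most e; Parseval applies to the K terms, and those beyond m are dropped as squares. *)
Lemma integral_beurling_ge (r : R) m : 1 < r ->
  ((2 * pi * \sum_(k < m) coef r k ^+ 2)%:E <=
  \int[lam]_(t in `[0%R, (2 * pi)%R]%classic)
     ((cnorm (beurling shell_mu ((r * cos t) +i* (r * sin t))%C)) ^+ 2)%:E)%E.
Proof.
move=> r1; apply/lee_addgt0Pr => e e0.
pose M := 2 * (pi^-1 * fine (leb2 (@diskD R))) / (r - 1) ^+ 2.
pose a := 2 / (r - 1) ^+ 2.
have r10 : 0 < (r - 1) ^+ 2 by rewrite exprn_gt0// subr_gt0.
have pi0 := @pi_gt0 R.
have a0 : 0 < a by rewrite divr_gt0.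
have M0 : 0 <= M by rewrite divr_ge0 ?(ltW r10)// mulr_ge0// mulr_ge0 ?invr_ge0 ?(ltW
  pi0)// fine_ge0.
(* With f the transform, P its partial sum, E the modulus of the tail and u = 1 - [radius2 K], one
   has |P|^2 - |f|^2 <= E (2 |f| + E), where |f| <= M and E <= a u <= a. Integrated over the circle,
   the error is at most D u. *)
pose D := 2 * pi * (a * (2 * M + a)).
have Ma0 : 0 < 2 * M + a by have := a0; have := M0; move=> *; lra.
have D0 : 0 < D by apply: mulr_gt0; [exact: mulr_gt0 | exact: mulr_gt0].
have [K0 HK0] := radius2_near1 (divr_gt0 e0 D0).
pose K := maxn m K0.
have := HK0 K (leq_maxr _ _); set u := 1 - radius2 K => hu.
have u0 : 0 <= u by rewrite subr_ge0 ltW// radius2_lt1.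
have u1 : u <= 1 by rewrite /u; have := radius2_gt0 K; lra.
pose eta := u * (a * (2 * M + a)).
have etae : 2 * pi * eta <= e.
  by move: hu; rewrite ler_pdivlMr// /D /eta => h; apply: le_trans h; rewrite le_eqVlt;
    apply/orP; left; apply/eqP; ring.
have key : ((2 * pi * (\sum_(k < K) coef r k ^+ 2 - eta))%:E <=
  \int[lam]_(t in `[0%R, (2 * pi)%R]%classic)
     ((cnorm (beurling shell_mu ((r * cos t) +i* (r * sin t))%C)) ^+ 2)%:E)%E.
  apply: (@integral_ge_trig_sqnorm R K (coef r) freq freq_inj eta
    (fun t => cnorm (beurling shell_mu ((r * cos t) +i* (r * sin t))%C) ^+ 2)) => t;
      first exact: sqr_ge0.
  rewrite -sqr_normc_sum_shell_piece// cnormE.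
  set z := (_ +i* _)%C; have zr : normc z = r.
    rewrite /z /= !exprMn -mulrDr cos2Dsin2 mulr1 sqrtr_sqr ger0_norm//.
    by rewrite ltW// (lt_trans ltr01).
  set P := \sum_(k < K) _; set f := beurling shell_mu z.
  have fP : f = P + beurling_tail K z := beurling_shell_mu K r1 zr.
  have hE := beurling_tail_le K r1 zr.
  have hf := beurling_shell_mu_le r1 zr.
  have hP : normc P <= normc f + normc (beurling_tail K z).
    by rewrite -[P](addrK (beurling_tail K z)) -fP; apply: le_trans (le_normcD _ _) _;
      rewrite normcN.
  set E := normc (beurling_tail K z) in hE hP.
  have E0 : 0 <= E by exact: normc_ge0.
  have Eu : E <= a * u by apply: le_trans hE _; rewrite /a /u le_eqVlt; apply/orP;
    left; apply/eqP; ring.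
  have f0 := normc_ge0 f; have P0 := normc_ge0 P.
  rewrite -/M in hf.
  have Ea : E <= a by apply: le_trans Eu _; rewrite ler_piMr// ltW.
  have s1 : normc P ^+ 2 <= (normc f + E) ^+ 2 by rewrite ler_sqr ?nnegrE// addr_ge0.
  have s2 : E * (2 * normc f + E) <= (a * u) * (2 * M + a).
    apply: ler_pM => //; first by rewrite addr_ge0// mulr_ge0.
    by apply: lerD => //; rewrite ler_pM2l.
  have : (normc f + E) ^+ 2 = normc f ^+ 2 + E * (2 * normc f + E) by ring.
  rewrite /eta; have -> : u * (a * (2 * M + a)) = a * u * (2 * M + a) by ring.
  move: s1 s2; lra.
apply: (@le_trans _ _ ((2 * pi * (\sum_(k < K) coef r k ^+ 2 - eta))%:E + e%:E)%E);
  last exact: leeD2r.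
rewrite -EFinD lee_fin mulrBr.
have mK : \sum_(k < m) coef r k ^+ 2 <= \sum_(k < K) coef r k ^+ 2.
  rewrite -!(big_mkord xpredT (fun k => coef r k ^+ 2)).
  rewrite [leRHS](big_cat_nat (n := m))//= ?leq_maxl// lerDl.
  by apply: sumr_ge0 => k _; exact: sqr_ge0.
have := ler_wpM2l (_ : 0 <= 2 * pi) mK => /(_ ltac:(by rewrite mulr_ge0// ltW)).
lra.
Qed.

End construction.

(** * Numerical constants *)

(* Large decimals are written in base 1000 since ring numerals are unary. *)
Section numerics.
Variable R : realType.

Lemma exp_series_le_expR (y : R) n : 0 <= y ->
  \sum_(i < n) y ^+ i / i`!%:R <= expR y.
Proof.
move=> y0; rewrite -(big_mkord xpredT (fun i => y ^+ i / i`!%:R)).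
rewrite /expR; apply: nondecreasing_cvgn_le; last exact: is_cvg_series_exp_coeff.
apply: nondecreasing_series => i _ _.
by rewrite /exp_coeff divr_ge0// exprn_ge0.
Qed.

(** Amounts to 20 <= exp 2.995733. Divided by 32 the exponent is about 0.094, where six Taylor terms
    are accurate enough; five squarings, with ten decimals kept in between, lead back. *)
Lemma ln20_le : ln 20 <= ((2 * 1000 + 995) * 1000 + 733) / 10 ^+ 6 :> R.
Proof.
(* The factor 32 is spelled as a product of twos so that [exprM] turns the power into iterated
   squares. *)
have y32 : ((2 * 1000 + 995) * 1000 + 733) / 10 ^+ 6 = (2 * 2 * 2 * 2 * 2)%N%:R * (((2
  * 1000 + 995) * 1000 + 733) / ((32 * 1000) * 1000)) :> R.
  by rewrite !natrM; field.
rewrite -ler_expR lnK ?posrE// y32 expRM_natl.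
set z : R := ((2 * 1000 + 995) * 1000 + 733) / ((32 * 1000) * 1000).
have z0 : 0 <= z by rewrite /z; lra.
have h0 : (((10 * 1000 + 981) * 1000 + 386) * 1000 + 996) / 10 ^+ 10 <= expR z.
  apply: le_trans (exp_series_le_expR 6 z0).
  rewrite !big_ord_recr big_ord0 /= /z !factS fact0 !expr0 !exprS.
  lra.
have sq (a b : R) : 0 <= a -> b <= a ^+ 2 -> forall E, a <= E -> b <= E ^+ 2.
  move=> a0 ba E aE; apply: le_trans ba _.
  by rewrite ler_sqr ?nnegrE// (le_trans a0).
rewrite !exprM.
have h1 : (((12 * 1000 + 59) * 1000 + 86) * 1000 + 35) / 10 ^+ 10 <= expR z ^+ 2.
  by apply: (sq ((((10 * 1000 + 981) * 1000 + 386) * 1000 + 996) / 10 ^+ 10)) h0;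
    rewrite ?expr2; lra.
have h2 : (((14 * 1000 + 542) * 1000 + 155) * 1000 + 599) / 10 ^+ 10 <= (expR z ^+ 2)
  ^+ 2.
  by apply: (sq ((((12 * 1000 + 59) * 1000 + 86) * 1000 + 35) / 10 ^+ 10)) h1;
    rewrite ?expr2; lra.
have h3 : (((21 * 1000 + 147) * 1000 + 428) * 1000 + 946) / 10 ^+ 10 <= ((expR z ^+ 2)
  ^+ 2) ^+ 2.
  by apply: (sq ((((14 * 1000 + 542) * 1000 + 155) * 1000 + 599) / 10 ^+ 10)) h2;
    rewrite ?expr2; lra.
have h4 : (((44 * 1000 + 721) * 1000 + 375) * 1000 + 102) / 10 ^+ 10 <= (((expR z ^+ 2)
  ^+ 2) ^+ 2) ^+ 2.
  by apply: (sq ((((21 * 1000 + 147) * 1000 + 428) * 1000 + 946) / 10 ^+ 10)) h3;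
    rewrite ?expr2; lra.
by apply: (sq ((((44 * 1000 + 721) * 1000 + 375) * 1000 + 102) / 10 ^+ 10)) h4;
  rewrite ?expr2; lra.
Qed.

(** Repeated squaring up to the exponent 16 with upper bounds of ten decimals, then 20 = 16 + 4. *)
Lemma exp20_le : ((85 * 1000 + 413) / 10 ^+ 5) ^+ 20 <= ((427 * 1000 + 50) * 1000 +
  783) / 10 ^+ 10 :> R.
Proof.
have sq (a b : R) : b ^+ 2 <= a -> forall E, 0 <= E -> E <= b -> E ^+ 2 <= a.
  move=> ba E E0 Eb; apply: le_trans ba.
  by rewrite ler_sqr ?nnegrE// (le_trans E0).
set X : R := (85 * 1000 + 413) / 10 ^+ 5; have X0 : 0 <= X by rewrite /X; lra.
have h2 : X ^+ 2 <= (((7 * 1000 + 295) * 1000 + 380) * 1000 + 569) / 10 ^+ 10 by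
  rewrite /X expr2; lra.
have h4 : (X ^+ 2) ^+ 2 <= (((5 * 1000 + 322) * 1000 + 257) * 1000 + 765) / 10 ^+ 10.
  by apply: (sq _ ((((7 * 1000 + 295) * 1000 + 380) * 1000 + 569) / 10 ^+ 10)) h2;
    rewrite ?sqr_ge0// expr2; lra.
have h8 : ((X ^+ 2) ^+ 2) ^+ 2 <= (((2 * 1000 + 832) * 1000 + 642) * 1000 + 772) / 10
  ^+ 10.
  by apply: (sq _ ((((5 * 1000 + 322) * 1000 + 257) * 1000 + 765) / 10 ^+ 10)) h4;
    rewrite ?sqr_ge0// expr2; lra.
have h16 : (((X ^+ 2) ^+ 2) ^+ 2) ^+ 2 <= ((802 * 1000 + 386) * 1000 + 508) / 10 ^+ 10.
  by apply: (sq _ ((((2 * 1000 + 832) * 1000 + 642) * 1000 + 772) / 10 ^+ 10)) h8;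
    rewrite ?sqr_ge0// expr2; lra.
rewrite (_ : X ^+ 20 = (((X ^+ 2) ^+ 2) ^+ 2) ^+ 2 * (X ^+ 2) ^+ 2); last by ring.
apply: le_trans (ler_pM _ _ h16 h4) _; rewrite ?sqr_ge0//.
lra.
Qed.

(** The constant 0.8791305 lies about halfway between 0.87913 and the value of about 0.8791311 that
    the construction yields; the factor (1 - 20^-6)^4 costs a relative 6.3 * 10^-8 only. *)
Lemma variance_constant_gt : ((8 * 1000 + 791) * 1000 + 305) / 10 ^+ 7 * ln 20 <
  4 * ((85 * 1000 + 413) / 10 ^+ 5 - ((85 * 1000 + 413) / 10 ^+ 5) ^+ 20) ^+ 2 * (1 -
    (20 ^+ 6)^-1) ^+ 4 :> R.
Proof.
apply: (@le_lt_trans _ _ (((8 * 1000 + 791) * 1000 + 305) / 10 ^+ 7 * (((2 * 1000 +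
  995) * 1000 + 733) / 10 ^+ 6))).
  apply: ler_wpM2l ln20_le; lra.
have h := exp20_le; set u := _ - _ ^+ 20.
have hu : (85 * 1000 + 413) / 10 ^+ 5 - ((427 * 1000 + 50) * 1000 + 783) / 10 ^+ 10 <=
  u by rewrite /u; lra.
apply: (@lt_le_trans _ _ (4 * ((85 * 1000 + 413) / 10 ^+ 5 - ((427 * 1000 + 50) * 1000
  + 783) / 10 ^+ 10) ^+ 2 * (1 - (20 ^+ 6)^-1) ^+ 4)).
  rewrite !exprS expr0; lra.
rewrite ler_pM2r; last by rewrite exprn_gt0// !exprS expr0; lra.
apply: ler_wpM2l; first by lra.
set v : R := _ - _ / _ in hu *.
have v0 : 0 <= v by rewrite /v; lra.
by rewrite ler_sqr ?nnegrE; [exact: hu | exact: v0 | exact: le_trans v0 hu].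
Qed.

End numerics.

(** * The asymptotic variance *)

Section lower_bound.
Variable R : realType.

Lemma inv_expD1_ge (y : R) N : 0 <= y -> 1 - N%:R * y <= ((1 + y) ^+ N)^-1.
Proof.
move=> y0; have y1 : 0 < 1 + y by rewrite ltr_pwDl.
rewrite -[leRHS]mul1r ler_pdivlMr ?exprn_gt0//.
elim: N => [|N IH]; first by rewrite mul0r subr0 expr0 mulr1.
rewrite -natr1 exprS mulrA; apply: le_trans IH.
apply: ler_wpM2r; first by rewrite exprn_ge0// ltW.
have : 0 <= (N%:R + 1) * y ^+ 2 by rewrite mulr_ge0// ?addr_ge0// sqr_ge0.
have -> : (1 - (N%:R + 1) * y) * (1 + y) = 1 - N%:R * y - (N%:R + 1) * y ^+ 2 by ring.
by move=> ?; lra.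
Qed.

Variable x : R.
Hypotheses (x0 : 0 < x) (x1 : x < 1).
(** A common bound for two relative losses in a coefficient: 20^-(k+1) in its constant, and the
    decay of r^-(20^(k+1)) at r = 1 + 20^-(n+12). Squaring the coefficient produces the fourth power
    in [level]. *)
Let delta : R := (20 ^+ 6)^-1.
Let level : R := 4 * (x - x ^+ 20) ^+ 2 * (1 - delta) ^+ 4.

Lemma coefE (r : R) k : coef x r k =
  2 * (1 - (20 ^+ k.+1)^-1) * (x - x ^+ 20) * (r ^+ (20 ^ k.+1))^-1.
Proof.
rewrite /coef freqE; congr (_ * _ / _).
have h : (half_freq k).+1%:R = 10 * 20 ^+ k :> R by rewrite half_freqS natrM natrX.
rewrite h -natr1 natrM.
have -> : (half_freq k)%:R = 10 * 20 ^+ k - 1 :> R by rewrite -h -natr1 addrK.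
have : 20 ^+ k != 0 :> R by rewrite expf_neq0// pnatr_eq0.
rewrite exprS; move: (20 ^+ k) => y y0.
by field.
Qed.

Lemma delta_gt0 : 0 < delta. Proof. by rewrite invr_gt0 exprn_gt0. Qed.
Lemma delta_lt1 : delta < 1. Proof. by rewrite invf_lt1 ?exprn_gt0// exprn_egt1//
  ltr1n. Qed.

Lemma sqr_coef_ge (n k : nat) : (5 <= k < n + 5)%N ->
  level <= coef x (1 + (20 ^+ (n + 12))^-1) k ^+ 2.
Proof.
move=> /andP[k5 kn]; rewrite coefE.
have d0 := delta_gt0; have d1 := delta_lt1.
have xx : 0 <= x - x ^+ 20.
  by rewrite subr_ge0 exprS ler_piMr// ?exprn_ile1// ltW.
set y : R := (20 ^+ (n + 12))^-1; have y0 : 0 <= y by rewrite invr_ge0 exprn_ge0.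
have e1 : (20 ^+ k.+1)^-1 <= delta.
  by rewrite /delta lef_pV2 ?posrE ?exprn_gt0// ler_weXn2l// ler1n.
have e2 : (20 ^ k.+1)%:R * y <= delta.
  rewrite /y /delta natrX ler_pdivrMr ?exprn_gt0//.
  rewrite mulrC ler_pdivlMr ?exprn_gt0// -exprD ler_weXn2l ?ler1n//.
  by rewrite -[(n + 12)%N]/(n + (5 + 7))%N addnA leq_add.
have e3 : 1 - delta <= ((1 + y) ^+ (20 ^ k.+1))^-1.
  apply: le_trans (inv_expD1_ge _ y0).
  by rewrite lerD2l lerN2.
have -> : level = (2 * (1 - delta) * (x - x ^+ 20) * (1 - delta)) ^+ 2 by rewrite
  /level; ring.
have d10 : 0 <= 1 - delta by rewrite subr_ge0 ltW.
have a0 : 0 <= 2 * (1 - delta) * (x - x ^+ 20) by rewrite mulr_ge0// mulr_ge0.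
have ab : 2 * (1 - delta) * (x - x ^+ 20) <= 2 * (1 - (20 ^+ k.+1)^-1) * (x - x ^+ 20).
  apply: ler_wpM2r => //; apply: ler_wpM2l => //.
  by rewrite lerD2l lerN2.
rewrite ler_sqr ?nnegrE.
- exact: ler_pM.
- exact: mulr_ge0.
- by apply: mulr_ge0; [exact: le_trans a0 ab | exact: le_trans d10 e3].
Qed.

(** Of the n + 12 terms the first 5, where the constant is not yet close to its limit, and the last
    7, where the power of r may be small, are discarded. *)
Lemma sum_sqr_coef_ge n :
  n%:R * level <= \sum_(k < n + 12) coef x (1 + (20 ^+ (n + 12))^-1) k ^+ 2.
Proof.
set c := coef x _; rewrite -(big_mkord xpredT (fun k => c k ^+ 2)).
have pos a b : 0 <= \sum_(a <= k < b) c k ^+ 2 by apply: sumr_ge0 => k _;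
  exact: sqr_ge0.
rewrite (big_cat_nat (n := 5))//=; last by rewrite (leq_trans _ (leq_addl _ _)).
rewrite (big_cat_nat (n := n + 5) (m := 5))//= ?leq_addl ?leq_add2l//.
apply: le_trans (_ : \sum_(5 <= k < n + 5) c k ^+ 2 <= _); last first.
  have := pos 0%N 5; have := pos (n + 5)%N (n + 12)%N; lra.
have -> : n%:R * level = \sum_(5 <= k < n + 5) level.
  by rewrite big_const_nat addnK iter_addr addr0 mulr_natl.
rewrite !big_nat; apply: ler_sum => k; exact: sqr_coef_ge.
Qed.

(** For each e it is enough to exhibit one radius in ]1, 1 + e[. At r = 1 + 20^-(n+12) the logarithm
    is (n + 12) ln 20, against n terms of size at least [level]. *)
Lemma sigma2_shell_mu_ge (c : R) : 0 < c -> c * ln 20 < level -> (c%:E <= sigma2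
  (shell_mu x))%E.
Proof.
move=> c0 cT; rewrite /sigma2.
have pi0 := @pi_gt0 R.
have pi2 : 0 < 2 * pi :> R by rewrite mulr_gt0.
have -> : c%:E = (((2 * pi)^-1)%:E * (2 * pi * c)%:E)%E.
  by rewrite -EFinM mulKf// gt_eqF.
apply: lee_wpmul2l; first by rewrite lee_fin invr_ge0 ltW.
rewrite /limsup_right; apply: le_ereal_inf_tmp => _ [e /= + <-].
rewrite in_itv /= andbT => e0.
have L0 : 0 < ln 20 :> R by rewrite ln_gt0// ltr1n.
(* The first bound gives (n + 12) c ln 20 <= n [level], absorbing the 12 discarded terms; the second
   gives 20^-(n+12) < e. *)
pose n := maxn (Num.truncn (12 * (c * ln 20) / (level - c * ln 20))).+1 (Num.truncn
  e^-1).+1.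
have Tc : 0 < level - c * ln 20 by rewrite subr_gt0.
have n1 : 12 * (c * ln 20) <= n%:R * (level - c * ln 20).
  rewrite -ler_pdivrMr//; apply/ltW/(lt_le_trans (truncnS_gt _)).
  by rewrite ler_nat leq_maxl.
have n2 : e^-1 < n%:R.
  apply: (lt_le_trans (truncnS_gt _)); by rewrite ler_nat leq_maxr.
set y : R := (20 ^+ (n + 12))^-1.
have y0 : 0 < y by rewrite invr_gt0 exprn_gt0.
have ye : y < e.
  rewrite /y -[e]invrK ltf_pV2 ?posrE ?exprn_gt0 ?invr_gt0//.
  apply: (lt_le_trans n2); rewrite -natrX ler_nat.
  by apply: leq_trans (leq_addr 12 _) _; rewrite ltnW// ltn_expl.
apply: le_ereal_sup_tmp; eexists.
  by exists (1 + y); [rewrite /= in_itv /= ltrDl y0 ltrD2l | reflexivity].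
have y1 : 1 + y - 1 = y by ring.
rewrite /= y1.
have lny : `|ln y| = (n + 12)%:R * ln 20.
  rewrite /y lnV ?posrE ?exprn_gt0// normrN lnXn// mulr_natl ger0_norm// mulrn_wge0//.
  exact: ltW.
have lp : 0 < (n + 12)%:R * ln 20 :> R by rewrite mulr_gt0// ltr0n addn_gt0 orbT.
rewrite lny; apply: le_trans (_ : (((n + 12)%:R * ln 20)^-1%:E *
  (2 * pi * \sum_(k < n + 12) coef x (1 + y) k ^+ 2)%:E <= _)%E); last first.
  apply: lee_wpmul2l; first by rewrite lee_fin invr_ge0 ltW.
  by apply: integral_beurling_ge => //; rewrite ltrDl.
rewrite -EFinM lee_fin [leRHS]mulrC ler_pdivlMr//.
rewrite -[leLHS]mulrA (ler_pM2l pi2).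
apply: le_trans (sum_sqr_coef_ge n).
by rewrite natrD; move: n1; move: (ln 20) level n%:R => l t N; lra.
Qed.

End lower_bound.

Theorem theorem1p2 (R : realType) :
  exists mu : R * R -> R[i],
    cmeasurable mu /\
    (forall p : R * R, cnorm (mu p) <= \1_(@diskD R) p) /\
    (sigma2 mu > (87913%:R / 100000%:R)%:E)%E.
Proof.
(* The maximizer 20^(-1/19) = 0.8541314... rounded to five decimals. *)
pose x : R := (85 * 1000 + 413) / 10 ^+ 5.
have x0 : 0 < x by rewrite /x; lra.
have x1 : x < 1 by rewrite /x; lra.
exists (shell_mu x); split; first exact: (cmeas_shell_mu x0 x1).
split; first by move=> p; rewrite cnormE -[leRHS]mul1r; exact: shell_mu_le.
(* The lower bound for [sigma2] is not strict; the intermediate constant 0.8791305 makes it so. *)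
apply: lt_le_trans (_ : (((8 * 1000 + 791) * 1000 + 305) / 10 ^+ 7)%:E <= _)%E; last first.
  apply: (sigma2_shell_mu_ge x0 x1); last exact: variance_constant_gt.
  lra.
rewrite lte_fin; lra.
Qed.
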